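(* Let $d\ge1$ be an integer and let $\{B^H(t):t\in[0,1]\}$ be a $d$-dimensional fractional Brownian motion of Hurst index $H\in(0,1)$. Let $f:[0,1]\to\mathbb{R}^d$ be a Borel measurable function and let $A\subset[0,1]$ be a Borel set. If $\dim_{\Psi,H}(Gr_A(f))>Hd$, then $\lambda_d\big((B^H+f)(A)\big)>0$ almost surely.
   Context: $\lambda_d$ is Lebesgue measure on $\mathbb{R}^d$, and $(B^H+f)(A)=\{B^H(t)+f(t):t\in A\}$ is the (random) image of $A$. A real-valued fractional Brownian motion of Hurst index $H\in(0,1)$ is a centered Gaussian process $B_0^H$ with covariance $\mathbb{E}(B_0^H(s)B_0^H(t))=\frac12(|t|^{2H}+|s|^{2H}-|t-s|^{2H})$. A $d$-dimensional fractional Brownian motion is $B^H=(B_1^H,\dots,B_d^H)$ with $B_1^H,\dots,B_d^H$ independent copies of $B_0^H$. Processes are defined on a complete probability space and taken with continuous sample paths. $Gr_A(f)=\{(t,f(t)):t\in A\}\subset\mathbb{R}_+\times\mathbb{R}^d$ is the graph of $f$ over $A$. For $\beta>0$ and $F\subset\mathbb{R}_+\times\mathbb{R}^d$, the $H$-parabolic $\beta$-dimensional Hausdorff content is $$\Psi_H^\beta(F)=\inf\Big\{\sum_j\delta_j^\beta:\ F\subseteq\bigcup_j [a_j,a_j+\delta_j]\times[b_{j,1},b_{j,1}+\delta_j^H]\times\cdots\times[b_{j,d},b_{j,d}+\delta_j^H]\Big\},$$ the infimum being over all countable covers of $F$ by sets of this form. The $H$-parabolic Hausdorff dimension is $\dim_{\Psi,H}(F)=\inf\{\beta>0:\Psi_H^\beta(F)=0\}$.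 *)

(* Defs.v *)
From HB Require Import structures.
From mathcomp Require Import all_boot all_order all_algebra.
From mathcomp Require Import all_classical all_reals all_analysis.

Set Implicit Arguments.
Unset Strict Implicit.
Unset Printing Implicit Defensive.

Import Order.TTheory GRing.Theory Num.Theory.
Import numFieldNormedType.Exports.

Local Open Scope classical_set_scope.
Local Open Scope ring_scope.

(* Measurability for the Borel sigma-algebra of the topology of R^d. *)
Definition borel_measurable_fun (R : realType) (d : nat) (D : set R)
    (f : R -> 'rV[R]_d) : Prop :=
  measurable_fun D (f : R -> g_sigma_algebraType (@open 'rV[R]_d)).

Section lebesgue_rV.
Variables (R : realType) (d : nat).

Definition box (a b : 'rV[R]_d) : set 'rV[R]_d :=
  [set x : 'rV[R]_d | forall i, a ord0 i <= x ord0 i <= b ord0 i].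

Definition box_volume (a b : 'rV[R]_d) : R :=
  \prod_(i < d) (b ord0 i - a ord0 i).

Definition box_cover (E : set 'rV[R]_d) (a b : nat -> 'rV[R]_d) : Prop :=
  (forall k i, a k ord0 i <= b k ord0 i) /\
  E `<=` \bigcup_k box (a k) (b k).

(* The Lebesgue outer measure on R^d, for 1 <= d. As with the library's
   [completed_lebesgue_measure], it is a total function on sets, whose
   restriction to its Caratheodory-measurable (that is, Lebesgue-measurable)
   sets is Lebesgue measure. *)
Definition lebesgue_measure_rV (E : set 'rV[R]_d) : \bar R :=
  ereal_inf [set s | exists a b : nat -> 'rV[R]_d,
    box_cover E a b /\
    s = (\sum_(0 <= k <oo) (box_volume (a k) (b k))%:E)%E].

End lebesgue_rV.

Section parabolic.
Variables (R : realType) (d : nat).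

Definition graph (A : set R) (f : R -> 'rV[R]_d) : set (R * 'rV[R]_d) :=
  [set (t, f t) | t in A].

Definition parabolic_box (H a : R) (b : 'rV[R]_d) (delta : R) :
    set (R * 'rV[R]_d) :=
  [set p : R * 'rV[R]_d | a <= p.1 <= a + delta /\
           forall i, b ord0 i <= p.2 ord0 i <= b ord0 i + delta `^ H].

(* Only used for 0 < beta. Then [0 `^ beta = 0], so that sides [delta j = 0]
   contribute nothing and sequences also account for finite covers. *)
Definition parabolic_content (H beta : R) (F : set (R * 'rV[R]_d)) : \bar R :=
  ereal_inf [set s | exists (a : nat -> R) (b : nat -> 'rV[R]_d)
      (delta : nat -> R),
    [/\ forall j, 0 <= delta j,
        F `<=` \bigcup_j parabolic_box H (a j) (b j) (delta j) &
        s = (\sum_(0 <= j <oo) (delta j `^ beta)%:E)%E]].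

Definition parabolic_dim (H : R) (F : set (R * 'rV[R]_d)) : \bar R :=
  ereal_inf [set beta%:E | beta in
    [set beta : R | 0 < beta /\ parabolic_content H beta F = 0%E]].

End parabolic.

Section processes.
Context (disp : measure_display) (T : measurableType disp) (R : realType).
Variable P : probability T R.

(* [normal_prob m 0] is not a Dirac mass in the library: its density is by
   convention that of the uniform law on [0, 1]. *)
Definition gaussian_law (m s : R) : set R -> \bar R :=
  if s == 0 then \d_m else normal_prob m s.

Definition gaussian_variable (Y : T -> R) : Prop :=
  exists m s : R, forall E : set R, measurable E ->
    P (Y @^-1` E) = gaussian_law m s E.

Definition gaussian_process (I : set R) (X : R -> {RV P >-> R}) : Prop :=
  forall (n : nat) (t c : 'I_n -> R), (forall k, I (t k)) ->
    gaussian_variable (fun w => \sum_(k < n) c k * X (t k) w).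

(* Real fractional Brownian motion of Hurst index [H] with times in [I]; the
   variables [X t] for [t] outside of [I] are irrelevant. *)
Definition is_fBm1 (H : R) (I : set R) (X : R -> {RV P >-> R}) : Prop :=
  [/\ gaussian_process I X,
      forall t, I t -> ('E_P[X t] = 0)%E &
      forall s t, I s -> I t ->
        'E_P[(fun w => X s w * X t w)%R]%E =
        (2^-1 * (`|t| `^ (2 * H) + `|s| `^ (2 * H)
                 - `|t - s| `^ (2 * H)))%:E].

Definition sigma_process (I : set R) (X : R -> {RV P >-> R}) : set (set T) :=
  <<s [set G | exists t (E : set R),
        [/\ I t, measurable E & G = X t @^-1` E]] >>.

(* No quantification over subfamilies is needed, since [setT] belongs to each
   of the sigma-algebras. *)
Definition independent_processes (d : nat) (I : set R)
    (X : 'I_d -> R -> {RV P >-> R}) : Prop :=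
  forall G : 'I_d -> set T, (forall i, sigma_process I (X i) (G i)) ->
    P (\bigcap_i G i) = (\prod_(i < d) P (G i))%E.

Definition vector_process (d : nat) (X : 'I_d -> R -> {RV P >-> R})
    (t : R) (w : T) : 'rV[R]_d := \row_i X i t w.

Definition is_fBm (d : nat) (H : R) (I : set R)
    (B : 'I_d -> R -> {RV P >-> R}) : Prop :=
  [/\ forall i, is_fBm1 H I (B i),
      independent_processes I B &
      forall w, {within I, continuous (fun t => vector_process B t w)}].

End processes.

(* Main.v *)
Require Import Defs.
From HB Require Import structures.
From mathcomp Require Import all_boot all_order all_algebra.
From mathcomp Require Import all_classical all_reals all_analysis.
From mathcomp Require Import measurable_realfun lebesgue_integral_fubini.
From mathcomp Require Import ring lra zify.

Import Order.TTheory GRing.Theory Num.Theory.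
Import numFieldNormedType.Exports.

Local Open Scope classical_set_scope.
Local Open Scope ring_scope.

Set Implicit Arguments.
Unset Strict Implicit.
Unset Printing Implicit Defensive.

(** The proof is the second-moment method for an occupation measure.  Choose beta
    with H * d < beta < dim.  Frostman's lemma for parabolic boxes gives a
    probability measure nu on A under which a parabolic box of side delta around
    a piece of the graph of f has mass O(delta ^ beta).  For two times s and t,
    the Gaussian increment of the process and the drift difference f t - f s
    together land in a given cube of side r with probability
    O(r ^ d * rho ^ (- d)), where rho is the larger of |t - s| ^ H and
    |f t - f s|, that is, the parabolic distance of the two points of the graph
    raised to the power H ([fBm_small_ball]).  Since beta > H * d, the kernel
    rho ^ (- d) is integrable against nu x nu, as seen by summing over dyadic
    scales ([neighbours_le], [collision_probability_le]).  Hence the image nu_w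
    of nu under t |-> B t w + f t satisfies
      E (sum of nu_w(Q) ^ 2 over the cubes Q of side 2 ^ (- n)) = O(2 ^ (- n d)).
    By Fatou's lemma, almost surely the sum is at most K * 2 ^ (- n d) for
    infinitely many n, which is a discrete form of nu_w having a density in L^2:
    a finite union of boxes of small volume meets few small cubes, and by a
    Cauchy-Schwarz argument carries little nu_w-mass, so nu_w cannot be carried
    by a set of Lebesgue measure zero ([lebesgue_positive_image],
    [random_positive_image]).  The image of A carries nu_w.

    Frostman's lemma has to cover an arbitrary Borel set A and a Borel drift f,
    hence a graph that is merely Borel.  Interleaving the binary digits of t and
    of f t, with floor (n * H) digits of every space coordinate for n digits of
    t, identifies the graph with a Borel set of the Cantor space for which
    parabolic boxes become cylinders up to constants.  There,
    - the content defined by covers with weighted cylinders is continuous along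
      increasing sequences of arbitrary sets ([net_content_bigcup]);
    - Borel sets are projections of trees on nat x bool, and bounding the nat
      witness one coordinate at a time, at almost no loss of content, exhibits a
      compact subset of large content ([suslin_measurable],
      [exists_truncation_bounds], [bigcap_truncation]);
    - a function g on cylinders that is dominated by the weights and by the sum
      of its values on the two halves of a cylinder dominates a measure,
      obtained by sharing the mass of a cylinder between its halves in
      proportion to g ([splitting_measure]).
    The last two points give [frostman_cantor]. *)

(** * Net contents on the Cantor space *)

(** The last digit comes first, so that a node [b :: v] is a child of [v], its
    ancestors are its suffixes, and functions on the tree are defined by
    structural recursion. *)
Fixpoint pre (x : nat -> bool) (n : nat) : seq bool :=
  if n is m.+1 then x m :: pre x m else [::].

Definition cyl (u : seq bool) : set (nat -> bool) :=
  [set x | pre x (size u) = u].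

Lemma size_pre x n : size (pre x n) = n.
Proof. by elim: n => //= n ->. Qed.

Lemma pre_suffix x m n : (m <= n)%N -> suffix (pre x m) (pre x n).
Proof.
elim: n => [|n IHn]; first by rewrite leqn0 => /eqP ->.
rewrite leq_eqVlt => /orP[/eqP ->|]; first exact: suffix_refl.
by rewrite ltnS => /IHn /suffixP[p] /= ->; apply/suffixP; exists (x n :: p).
Qed.

Lemma suffix_pre x v n : suffix v (pre x n) -> v = pre x (size v).
Proof.
elim: n v => [|n IHn] v /=.
  by move/suffixP => [] [|? ?] //= <-.
move/suffixP => [] [|b p] /=; first by move=> <- /=; rewrite size_pre.
by case=> _ h; apply: IHn; apply/suffixP; exists p.
Qed.

Lemma suffix_size_le (u v : seq bool) : suffix u v -> (size u <= size v)%N.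
Proof. by move/suffixP => [p ->]; rewrite size_cat leq_addl. Qed.

Lemma cyl_comparable x (u v : seq bool) : cyl u x -> cyl v x ->
  (size u <= size v)%N -> suffix u v.
Proof. by rewrite /cyl /= => <- <-; rewrite !size_pre; exact: pre_suffix. Qed.

Lemma suffix_cyl x (u v : seq bool) : suffix u v -> cyl v x -> cyl u x.
Proof. by rewrite /cyl /= => + h; rewrite -h => /suffix_pre. Qed.

Definition antichain (C : set (seq bool)) :=
  forall u v, C u -> C v -> suffix u v -> u = v.

Definition covers (C : set (seq bool)) (E : set (nat -> bool)) :=
  E `<=` \bigcup_(u in C) cyl u.

Definition minimal_nodes (C : set (seq bool)) : set (seq bool) :=
  [set u | C u /\ forall v, C v -> suffix v u -> v = u].

Lemma minimal_nodes_antichain C : antichain (minimal_nodes C).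
Proof. by move=> u v [Cu _] [_ hv]; exact: hv. Qed.

Lemma minimal_suffix C u : C u ->
  exists2 v, minimal_nodes C v & suffix v u.
Proof.
move: {2}(size u).+1 (ltnSn (size u)) => k; elim: k u => // k IHk u uk Cu.
have [h|/existsNP[v /not_implyP[Cv /not_implyP[vu nvu]]]] :=
  pselect (forall v, C v -> suffix v u -> v = u).
  by exists u => //; exact: suffix_refl.
have sv : (size v < size u)%N.
  rewrite ltn_neqAle suffix_size_le // andbT; apply/eqP => svu; apply: nvu.
  case/suffixP: vu svu => -[|b p] -> //=; rewrite size_cat => /eqP.
  by rewrite -[X in X == _]add0n -addSn eqn_add2r.
have [v' mv' v'v] := IHk v (leq_trans sv uk) Cv.
exists v' => //; exact: suffix_trans v'v vu.
Qed.

Lemma minimal_nodes_covers C E : covers C E -> covers (minimal_nodes C) E.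
Proof.
move=> h x /h[u Cu xu]; have [v mv vu] := minimal_suffix Cu.
by exists v => //; exact: suffix_cyl xu.
Qed.

Section net_content.
Context {R : realType}.
Variable w : nat -> R.
Hypothesis w0 : forall n, 0 <= w n.
Local Open Scope ereal_scope.

Definition weight (C : set (seq bool)) : \bar R :=
  \esum_(u in C) (w (size u))%:E.

(** The analogue on the binary tree of a Hausdorff content, [w n] being the cost
    of a cylinder of level [n]. *)
Definition net_content (E : set (nat -> bool)) : \bar R :=
  ereal_inf [set weight C | C in [set C | covers C E]].

Lemma weight_ge0 C : 0 <= weight C.
Proof. by apply: esum_ge0 => u _; rewrite lee_fin. Qed.

Lemma weight_sub C D : C `<=` D -> weight C <= weight D.
Proof.
move=> CD; apply: ge_ereal_sup => _ [F [finF FC] <-].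
apply: ereal_sup_ubound; exists F => //; split=> //; exact: subset_trans CD.
Qed.

Lemma weightU C D : weight (C `|` D) <= weight C + weight D.
Proof.
rewrite /weight (esumID C) => [|u _]; last by rewrite lee_fin.
by apply: leeD; apply: weight_sub => u [] // [].
Qed.

Lemma weightID C D : weight C = weight (C `&` D) + weight (C `&` ~` D).
Proof. by rewrite /weight (esumID D) => // u _; rewrite lee_fin. Qed.

Lemma net_content_ge0 E : 0 <= net_content E.
Proof. by apply: le_ereal_inf_tmp => _ [C _ <-]; exact: weight_ge0. Qed.

Lemma net_content_le_weight C E : covers C E -> net_content E <= weight C.
Proof. by move=> h; apply: ereal_inf_lbound; exists C. Qed.

Lemma net_content_sub E F : E `<=` F -> net_content E <= net_content F.
Proof.
move=> EF; apply: le_ereal_inf_tmp => _ [C hC <-]; apply: net_content_le_weight.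
exact: subset_trans hC.
Qed.

Lemma net_content_cyl E u : E `<=` cyl u -> net_content E <= (w (size u))%:E.
Proof.
move=> Eu; have -> : (w (size u))%:E = weight [set u].
  by rewrite /weight esum_set1 // lee_fin.
by apply: net_content_le_weight => x /Eu xu; exists u.
Qed.

Lemma net_content_fin_num E : net_content E \is a fin_num.
Proof.
rewrite ge0_fin_numE ?net_content_ge0 //; apply: (le_lt_trans _ (ltry (w 0))).
by apply: (net_content_cyl (u := [::])).
Qed.

Lemma net_content_adherent E (e : R) : (0 < e)%R ->
  exists C, [/\ antichain C, covers C E & weight C <= net_content E + e%:E].
Proof.
move=> e0; have := lb_ereal_inf_adherent e0 (net_content_fin_num E).
move=> [_ [C hC <-] /ltW wC]; exists (minimal_nodes C); split.
- exact: minimal_nodes_antichain.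
- exact: minimal_nodes_covers.
- by apply: le_trans wC; apply: weight_sub => u [].
Qed.

Lemma net_contentU E F : net_content (E `|` F) <= net_content E + net_content F.
Proof.
apply/lee_addgt0Pr => e e0; have e20 : (0 < e / 2)%R by rewrite divr_gt0.
have [C [_ hC wC]] := net_content_adherent E e20.
have [D [_ hD wD]] := net_content_adherent F e20.
apply: (@le_trans _ _ (weight (C `|` D))).
  apply: net_content_le_weight => x [/hC|/hD] [u Cu xu]; exists u => //; by [left|right].
apply: (le_trans (weightU _ _)); apply: (le_trans (leeD wC wD)).
by rewrite addeACA -EFinD -splitr.
Qed.

(** Together with [overlap], this realises the strong subadditivity of the net
    content: of two comparable nodes from the two covers the larger cylinder goes
    to the union and the smaller one to the intersection. An element common to
    both covers is kept from [C] by [merge_covers] and from [D] by [overlap]. *)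
Definition merge_covers (D C : set (seq bool)) : set (seq bool) :=
  (D `&` ~` [set u | exists2 v, C v & suffix v u]) `|`
  (C `&` ~` [set v | exists u, [/\ D u, suffix u v & u <> v]]).

Definition overlap (D C : set (seq bool)) : set (seq bool) :=
  (D `&` [set u | exists2 v, C v & suffix v u]) `|`
  (C `&` [set v | exists u, [/\ D u, suffix u v & u <> v]]).

Lemma weight_merge_covers D C :
  weight (merge_covers D C) + weight (overlap D C) <= weight D + weight C.
Proof.
apply: (le_trans (leeD (weightU _ _) (weightU _ _))).
rewrite addeACA (addeC (weight (D `&` ~` _))) (addeC (weight (C `&` ~` _))).
by rewrite -!weightID.
Qed.

Lemma overlap_covers D C E : covers D E -> covers C E ->
  covers (overlap D C) E.
Proof.
move=> hD hC x Ex; have [u Du xu] := hD x Ex; have [v Cv xv] := hC x Ex.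
have [vu|uv] := leqP (size v) (size u).
  by exists u => //; left; split => //; exists v => //; exact: cyl_comparable xu vu.
exists v => //; right; split => //; exists u; split => //.
  by apply: cyl_comparable xv (ltnW uv).
by move=> uv'; move: uv; rewrite uv' ltnn.
Qed.

Lemma suffix_anti (u v : seq bool) : suffix u v -> suffix v u -> u = v.
Proof.
case/suffixP => p ->; move/suffix_size_le; rewrite size_cat.
by case: p => //= b p; rewrite addSn ltnNge leq_addl.
Qed.

Lemma merge_covers_antichain D C : antichain D -> antichain C ->
  antichain (merge_covers D C).
Proof.
move=> aD aC u v [[Du nu]|[Cu nu]] [[Dv nv]|[Cv nv]] uv; [exact: aD| | |exact: aC].
- have [//|uv'] := pselect (u = v).
  by exfalso; apply: nv; exists u.
- by exfalso; apply: nv; exists u.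
Qed.

Lemma merge_covers_refinesr D C u : antichain D -> antichain C -> D u ->
  exists2 v, merge_covers D C v & suffix v u.
Proof.
move=> aD aC Du.
have [[v Cv vu]|nu] := pselect (exists2 v, C v & suffix v u).
  exists v => //; right; split => // -[u' [Du' u'v nu'v]]; apply: nu'v.
  apply: suffix_anti => //.
  by rewrite (aD _ _ Du' Du (suffix_trans u'v vu)).
by exists u; [left|exact: suffix_refl].
Qed.

Lemma merge_covers_refinesl D C v : antichain D -> antichain C -> C v ->
  exists2 u, merge_covers D C u & suffix u v.
Proof.
move=> aD aC Cv.
have [[u [Du uv nuv]]|nv] := pselect (exists u, [/\ D u, suffix u v & u <> v]).
  exists u => //; left; split => // -[v' Cv' v'u]; apply: nuv.
  apply: suffix_anti => //.
  by rewrite -(aC _ _ Cv' Cv (suffix_trans v'u uv)).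
by exists v; [right|exact: suffix_refl].
Qed.

(** Near-optimal antichain covers [C n] of the sets [E n] are merged one after
    the other. Strong subadditivity charges to step [n + 1] only the excess of [C
    n.+1] and the increase of the content, so that the merged covers [D n] keep a
    total weight close to the content of [E n]. Every point of [E N] lies in
    cylinders of [D n], for [n >= N], that only grow with [n], hence stabilise;
    the nodes that eventually belong to [D n] form the desired cover. *)
Lemma net_content_bigcup (E : nat -> set (nat -> bool)) (L : \bar R) :
  (forall n, E n `<=` E n.+1) -> (forall n, net_content (E n) <= L) ->
  net_content (\bigcup_n E n) <= L.
Proof.
move=> incE hL; apply/lee_addgt0Pr => e e0.
have en0 n : (0 < e * 2^-1 ^+ n.+1)%R by rewrite mulr_gt0 // exprn_gt0.
have [C hC] := choice (fun n => net_content_adherent (E n) (en0 n)).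
pose D := fix D n := if n is m.+1 then merge_covers (D m) (C m.+1) else C 0%N.
have aC n : antichain (C n) by case: (hC n).
have cC n : covers (C n) (E n) by case: (hC n).
have aD n : antichain (D n).
  by elim: n => [|n IHn] /=; [exact: aC|exact: merge_covers_antichain].
have cD n : covers (D n) (E n).
  case: n => [|n]; first exact: cC.
  move=> x /cC[v Cv xv]; have [u mu uv] := merge_covers_refinesl (aD n) (aC n.+1) Cv.
  by exists u => //; exact: suffix_cyl xv.
have wD n : weight (D n) <= net_content (E n) + (e * (1 - 2^-1 ^+ n.+1))%:E.
  elim: n => [|n IHn] /=.
    have [_ _ h] := hC 0%N; apply: (le_trans h); rewrite leeD2l // lee_fin.
    by apply: ler_wpM2l; [exact: ltW|rewrite !expr1; lra].
  have [_ _ hn] := hC n.+1.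
  have h1 := weight_merge_covers (D n) (C n.+1).
  have h2 : net_content (E n) <= weight (overlap (D n) (C n.+1)).
    apply/net_content_le_weight/overlap_covers; first exact: cD.
    exact: subset_trans (incE n) (cC n.+1).
  have := le_trans (leeD (lexx (weight (merge_covers (D n) (C n.+1)))) h2) 
    (le_trans h1 (leeD IHn hn)).
  rewrite [leRHS]addeC (addeC (net_content (E n)) _) addeA.
  rewrite leeD2rE ?net_content_fin_num // => h; apply: (le_trans h).
  rewrite -addeA leeD2l // -EFinD lee_fin -mulrDr.
  apply: ler_wpM2l; first exact: ltW.
  by rewrite (exprS _ n.+1); lra.
pose Dl := [set u | exists N, forall n, (N <= n)%N -> D n u].
have cDl : covers Dl (\bigcup_n E n).
  move=> x [N _ ENx].
  have [u0 Du0 xu0] := cD N x ENx.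
  (* The cylinder of [D n] around [x] can only grow with [n]; its level
     therefore reaches a minimum, after which it no longer changes. *)
  pose Q k := `[< exists n, (N <= n)%N /\ exists2 u, D n u & cyl u x /\ size u = k >].
  have exQ : exists k, Q k.
    by exists (size u0); apply/asboolP; exists N; split => //; exists u0.
  have [k /asboolP[n [Nn [u Du [xu su]]]] kmin] := ex_minnP exQ.
  exists u => //; exists n => m nm; elim: m nm => [|m IHm].
    by rewrite leqn0 => /eqP <-.
  rewrite leq_eqVlt => /orP[/eqP <- //|]; rewrite ltnS => nm.
  have [v mv vu] := merge_covers_refinesr (aD m) (aC m.+1) (IHm nm).
  have xv := suffix_cyl vu xu.
  suff -> : u = v by [].
  have : Q (size v).
    apply/asboolP; exists m.+1; split; last by exists v.
    by rewrite (leq_trans Nn) // (leq_trans nm).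
  move/kmin; rewrite -su => szuv.
  exact: suffix_anti (cyl_comparable xu xv szuv) vu.
apply: (le_trans (net_content_le_weight cDl)); apply: ge_ereal_sup => _ [F [finF FD] <-].
have [N hN] : exists N, F `<=` D N.
  have [g hg] : {g : seq bool -> nat & forall u, F u -> forall n, (g u <= n)%N -> D n u}.
    apply: (@choice _ _ (fun u g => F u -> forall n, (g <= n)%N -> D n u)) => u.
    have [/FD[N hN]|nF] := pselect (F u); first by exists N.
    by exists 0%N.
  exists (\max_(u <- finmap.enum_fset (fset_set F)) g u)%N => u Fu; apply: (hg u Fu).
  have uF : u \in finmap.enum_fset (fset_set F).
    by have := in_fset_set finF u; rewrite mem_set.
  exact: (@leq_bigmax_seq _ _ xpredT g u uF).
apply: (@le_trans _ _ (weight (D N))).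
  by apply: ereal_sup_ubound; exists F.
apply: (le_trans (wD N)); apply: leeD; first exact: hL.
rewrite lee_fin -[leRHS]mulr1; apply: ler_wpM2l; first exact: ltW.
by rewrite gerBl exprn_ge0.
Qed.

End net_content.

(** * Borel sets of the Cantor space are capacitable *)

Definition agree (A : Type) (n : nat) (x y : nat -> A) :=
  forall i, (i < n)%N -> x i = y i.

Definition finite_modulus (N : nat)
    (T : (nat -> nat) -> (nat -> bool) -> Prop) :=
  forall s s' x x', agree N s s' -> agree N x x' -> T s x -> T s' x'.

(** The existential quantifier ranges over the branches of a tree: the condition
    [T n] reads finitely many digits of the witness and of the point. *)
Definition suslin (E : set (nat -> bool)) :=
  exists T : nat -> (nat -> nat) -> (nat -> bool) -> Prop,
    (forall n, finite_modulus n (T n)) /\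
    E = [set x | exists s, forall n, T n s x].

Lemma agree_sub (A : Type) m n (x y : nat -> A) :
  (m <= n)%N -> agree n x y -> agree m x y.
Proof. by move=> mn h i im; apply: h; exact: leq_trans mn. Qed.

(** It is enough that each condition depends on finitely many digits: a condition
    may be delayed until its digits are available. *)
Lemma suslin_of_modulus (T : nat -> (nat -> nat) -> (nat -> bool) -> Prop)
    (N : nat -> nat) :
  (forall n, finite_modulus (N n) (T n)) ->
  suslin [set x | exists s, forall n, T n s x].
Proof.
move=> hT.
exists (fun m s x => forall n, (n <= m)%N -> (N n <= m)%N -> T n s x); split.
  move=> m s s' x x' ss' xx' h n nm Nm; apply: (hT n) (h n nm Nm).
    exact: agree_sub ss'.
  exact: agree_sub xx'.
apply/seteqP; split=> x /= [s hs]; exists s => n; first by move=> k _ _.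
by apply: (hs (maxn n (N n))); rewrite ?leq_maxl ?leq_maxr.
Qed.

Lemma suslin_coordinate (i : nat) (b : bool) :
  suslin [set x : nat -> bool | x i = b].
Proof.
have := @suslin_of_modulus (fun n s x => x i = b) (fun=> i.+1) _.
move=> h; have -> : [set x : nat -> bool | x i = b] =
  [set x | exists s : nat -> nat, nat -> x i = b].
  by apply/seteqP; split=> x /=; [move=> ?; exists id|case=> s; exact].
by apply: h => n s s' x x' _ xx' <-; rewrite xx'.
Qed.

(** The first digit of the witness chooses the member of the union. *)
Lemma suslin_bigcup (E : nat -> set (nat -> bool)) :
  (forall k, suslin (E k)) -> suslin (\bigcup_k E k).
Proof.
move=> /choice[T hT].
have -> : \bigcup_k E k =
    [set x | exists s, forall n, T (s 0%N) n (fun i => s i.+1) x].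
  apply/seteqP; split=> x /=.
    move=> [k _]; rewrite (hT k).2 => -[s hs].
    by exists (fun i => if i is j.+1 then s j else k).
  by move=> [s hs]; exists (s 0%N) => //; rewrite (hT _).2; exists (fun i => s i.+1).
apply: (@suslin_of_modulus _ S) => n s s' x x' ss' xx'.
rewrite -(ss' 0%N) //; apply: (hT _).1; last exact: agree_sub xx'.
by move=> i ni; apply: ss'.
Qed.

(** A sequence of witnesses is coded by one witness through an enumeration of the
    pairs of natural numbers. *)
Lemma suslin_bigcap (E : nat -> set (nat -> bool)) :
  (forall k, suslin (E k)) -> suslin (\bigcap_k E k).
Proof.
move=> /choice[T hT].
pose p m : nat * nat := odflt (0%N, 0%N) (unpickle m).
have pK k i : p (pickle (k, i)) = (k, i) by rewrite /p pickleK.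
have -> : \bigcap_k E k = [set x | exists s : nat -> nat,
    forall m, T (p m).1 (p m).2 (fun j => s (pickle ((p m).1, j))) x].
  apply/seteqP; split=> x /=.
    move=> h; have {h} /choice[s hs] : forall k, exists s, forall n, T k n s x.
      by move=> k; have := h k I; rewrite (hT k).2.
    exists (fun m => s (p m).1 (p m).2) => m.
    apply: ((hT _).1 _ _ _ _ _ _ _ (hs (p m).1 (p m).2)) => // j _.
    by rewrite pK.
  move=> [s hs] k _; rewrite (hT k).2; exists (fun j => s (pickle (k, j))) => n.
  by have := hs (pickle (k, n)); rewrite pK.
pose N m := maxn (p m).2 (\max_(j < (p m).2) (pickle ((p m).1, j : nat)).+1)%N.
apply: (@suslin_of_modulus _ N) => m s s' x x' ss' xx'.
apply: (hT _).1; last by apply: agree_sub xx'; rewrite leq_maxl.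
move=> j jm; apply: ss'; rewrite leq_max; apply/orP; right.
exact: (@leq_bigmax _ (fun j : 'I_(p m).2 =>
  (pickle ((p m).1, j : nat)).+1) (Ordinal jm)).
Qed.

Definition coordinate_sets : set (set (nat -> bool)) :=
  [set G | exists i, G = [set x | x i = true]].

Notation cantor := (g_sigma_algebraType coordinate_sets).

(** The sets that are Suslin together with their complements form a
    sigma-algebra. *)
Lemma suslin_measurable (E : set cantor) : measurable E -> suslin E.
Proof.
move=> mE; suff: (suslin E /\ suslin (~` E)) by case.
apply: (mE [set E | suslin E /\ suslin (~` E)]); split; last first.
  move=> _ [i ->]; split; first exact: suslin_coordinate.
  have -> : ~` [set x : nat -> bool | x i = true] = [set x | x i = false].
    by apply/seteqP; split=> x /=; [move/negP/negbTE|move=> ->].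
  exact: suslin_coordinate.
have s0 : suslin set0.
  have -> : set0 = \bigcap_(k : nat) [set x : nat -> bool | x 0%N = odd k].
    apply/seteqP; split=> x //= h.
    by have := h 0%N I; have /= -> := h 1%N I.
  by apply: suslin_bigcap => k; exact: suslin_coordinate.
have sT : suslin (~` set0).
  have -> : ~` set0 = \bigcup_(k : nat) [set x : nat -> bool | x 0%N = odd k].
    apply/seteqP; split=> x /= _; last by [].
    by case e: (x 0%N); [exists 1%N|exists 0%N].
  by apply: suslin_bigcup => k; exact: suslin_coordinate.
split.
- by [].
- by move=> A [sA sA']; rewrite setTD; split=> //; rewrite setCK.
- move=> A hA; split.
    by apply: suslin_bigcup => k; case: (hA k).
  by rewrite setC_bigcup; apply: suslin_bigcap => k; case: (hA k).
Qed.

Section capacitability.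
Context {R : realType}.
Variable w : nat -> R.
Hypothesis w0 : forall n, 0 <= w n.
Variable T : nat -> (nat -> nat) -> (nat -> bool) -> Prop.
Hypothesis Tmod : forall n, finite_modulus n (T n).

Definition bounded_by (b : nat -> nat) k (s : nat -> nat) :=
  forall i, (i < k)%N -> (s i <= b i)%N.

(** With the first [k] digits of the witness bounded by [b] and only the first
    conditions tested, this set is a finite union of cylinders; it is a compact
    outer approximation of the set of points that have a witness bounded by [b]. *)
Definition truncation (b : nat -> nat) (k : nat) : set (nat -> bool) :=
  [set x | exists s, bounded_by b k s /\ forall n, (n <= k)%N -> T n s x].

Lemma truncation_sub b k m : (k <= m)%N -> truncation b m `<=` truncation b k.
Proof.
move=> km x [s [bs hs]]; exists s; split=> [i ik|n nk].
  by apply: bs; exact: leq_trans km.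
by apply: hs; exact: leq_trans km.
Qed.

Lemma truncation_agree b k x y : agree k x y -> truncation b k x ->
  truncation b k y.
Proof.
move=> xy [s [bs hs]]; exists s; split=> // n nk.
by apply: Tmod (hs n nk) => //; exact: agree_sub xy.
Qed.

(** Bounding one more digit of the witness by [m] gives sets that increase with
    [m] to the set without that bound, so continuity along increasing sequences
    provides an [m] that keeps the content above [c]. *)
Lemma exists_truncation_bounds (c : \bar R) :
  (c < net_content w [set x | exists s, forall n, T n s x])%E ->
  exists b : nat -> nat, forall k, (c < net_content w (truncation b k))%E.
Proof.
move=> hc.
pose E (b : seq nat) : set (nat -> bool) :=
  [set x | exists s, bounded_by (nth 0%N b) (size b) s /\ forall n, T n s x].
have step b : (c < net_content w (E b))%E ->
    exists m, (c < net_content w (E (rcons b m)))%E.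
  move=> cb; apply: contrapT => /forallNP h.
  have : (net_content w (E b) <= c)%E.
    have -> : E b = \bigcup_m E (rcons b m).
      apply/seteqP; split=> x.
        move=> [s [bs hs]]; exists (s (size b)) => //; exists s; split=> // i.
        rewrite size_rcons ltnS nth_rcons leq_eqVlt => /orP[/eqP ->|ib].
          by rewrite ltnn eqxx.
        by rewrite ib; exact: bs.
      move=> [m _ [s [bs hs]]]; exists s; split=> // i ib.
      by have := bs i; rewrite size_rcons ltnS (ltnW ib) nth_rcons ib; apply.
    apply: net_content_bigcup => // m.
      move=> x [s [bs hs]]; exists s; split=> // i; rewrite size_rcons => ib.
      have := bs i; rewrite size_rcons => /(_ ib) /leq_trans; apply.
      by rewrite !nth_rcons; case: ifP => // _; case: ifP.
    by rewrite leNgt; apply/negP; exact: h.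
  by rewrite leNgt cb.
have [g hg] : {g : seq nat -> nat & forall b, (c < net_content w (E b))%E ->
    (c < net_content w (E (rcons b (g b))))%E}.
  apply: (@choice _ _ (fun b m => (c < net_content w (E b))%E ->
    (c < net_content w (E (rcons b m)))%E)) => b.
  have [/step[m hm]|nb] := pselect (c < net_content w (E b))%E; first by exists m.
  by exists 0%N => /nb.
pose B := fix B n := if n is m.+1 then rcons (B m) (g (B m)) else [::].
have sB n : size (B n) = n by elim: n => //= n IHn; rewrite size_rcons IHn.
have hB n : (c < net_content w (E (B n)))%E.
  elim: n => [|n IHn]; last exact: hg.
  apply: (lt_le_trans hc); apply: net_content_sub => x [s hs].
  by exists s; split.
have nthB n i : (i < n)%N -> nth 0%N (B n) i = g (B i).
  elim: n => // n IHn; rewrite ltnS leq_eqVlt /= nth_rcons sB => /orP[/eqP ->|h].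
    by rewrite ltnn eqxx.
  by rewrite h IHn.
exists (fun i => g (B i)) => k; apply: (lt_le_trans (hB k)); apply: net_content_sub.
move=> x [s [bs hs]]; exists s; split=> [i ik|n _]; last exact: hs.
by rewrite -(nthB k) //; apply: bs; rewrite sB.
Qed.

(** Koenig's lemma: the finite sequences below [b] that extend to a bounded
    witness for every number of tested conditions form a finitely branching tree
    without dead ends. *)
Lemma bigcap_truncation b :
  \bigcap_k truncation b k `<=` [set x | exists s, forall n, T n s x].
Proof.
move=> x hx.
pose good (p : seq nat) := forall k, exists s, [/\ bounded_by b k s,
  forall n, (n <= k)%N -> T n s x & forall i, (i < size p)%N -> s i = nth 0%N p i].
have step p : good p -> exists m, good (rcons p m).
  move=> gp; apply: contrapT => /forallNP h.
  have {h} /choice[K hK] : forall m, exists k, ~ exists s, [/\ bounded_by b k s,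
      forall n, (n <= k)%N -> T n s x &
      forall i, (i < (size p).+1)%N -> s i = nth 0%N (rcons p m) i].
    by move=> m; have /existsNP := h m; rewrite size_rcons.
  (* If every admissible next digit failed at some stage, all of them would
     fail at a common later stage. *)
  pose k := maxn (size p).+1 (\max_(m < (b (size p)).+1) K m)%N.
  have [s [bs Ts ps]] := gp k.
  have sb : (s (size p) < (b (size p)).+1)%N.
    by rewrite ltnS; apply: bs; rewrite leq_max leqnn.
  have Kk : (K (s (size p)) <= k)%N.
    rewrite leq_max; apply/orP; right.
    exact: (@leq_bigmax _ (fun m : 'I_(b (size p)).+1 => K m) (Ordinal sb)).
  apply: (hK (s (size p))); exists s; split.
  - by move=> i ik; apply: bs; exact: leq_trans Kk.
  - by move=> n nk; apply: Ts; exact: leq_trans Kk.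
  - move=> i; rewrite ltnS leq_eqVlt nth_rcons => /orP[/eqP ->|ip].
      by rewrite ltnn eqxx.
    by rewrite ip; exact: ps.
have [g hg] : {g : seq nat -> nat & forall p, good p -> good (rcons p (g p))}.
  apply: (@choice _ _ (fun p m => good p -> good (rcons p m))) => p.
  have [/step[m hm]|np] := pselect (good p); first by exists m.
  by exists 0%N => /np.
pose B := fix B n := if n is m.+1 then rcons (B m) (g (B m)) else [::].
have sB n : size (B n) = n by elim: n => //= n IHn; rewrite size_rcons IHn.
have hB n : good (B n).
  elim: n => [|n IHn]; last exact: hg.
  by move=> k; have [s [bs hs]] := hx k I; exists s; split.
have nthB n i : (i < n)%N -> nth 0%N (B n) i = g (B i).
  elim: n => // n IHn; rewrite ltnS leq_eqVlt /= nth_rcons sB => /orP[/eqP ->|h].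
    by rewrite ltnn eqxx.
  by rewrite h IHn.
exists (fun i => g (B i)) => n; have [s [_ Ts ps]] := hB n n.
apply: (Tmod _ _ (Ts n (leqnn n))) => // i i_n.
by rewrite ps ?sB // nthB.
Qed.

End capacitability.

(** * Frostman measures on the Cantor space *)

Section unit_interval_splitting.
Context {R : realType}.
Variable g : seq bool -> R.
Hypothesis g0 : forall u, 0 <= g u.
Hypothesis gsub : forall v, g v <= g (true :: v) + g (false :: v).
Hypothesis groot : 0 < g [::].

(** The mass of a cylinder is shared between its halves in proportion to [g]. If
    [g] vanishes on both halves, the quotient is zero by convention, which is
    consistent because the mass is then zero as well. *)
Fixpoint mass (u : seq bool) : R :=
  if u is b :: v then
    mass v * (g (b :: v) / (g (true :: v) + g (false :: v)))
  else 1.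

(** Left end of the interval of length [mass u] attached to [u]; the intervals
    attached to the two children of a node split its interval. Lebesgue measure
    on the unit interval is then transported to the Cantor space. *)
Fixpoint left_end (u : seq bool) : R :=
  if u is b :: v then left_end v + (if b then mass (false :: v) else 0) else 0.

Lemma mass_ge0 u : 0 <= mass u.
Proof.
elim: u => [|b v IHv] /=; first exact: ler01.
by rewrite mulr_ge0 // divr_ge0 // addr_ge0.
Qed.

(** By induction, [mass v * g [::] <= g v <= g (true :: v) + g (false :: v)], and
    the factor by which the mass is multiplied at a child is the value of [g]
    there over this sum. *)
Lemma mass_le u : mass u * g [::] <= g u.
Proof.
elim: u => [|b v IHv]; first by rewrite mul1r.
rewrite [mass _]/=; set S := _ + _.
have S0 : 0 <= S by rewrite addr_ge0.
have [SE|/eqP Sn] := pselect (S = 0); first by rewrite SE invr0 mulr0 mulr0 mul0r.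
have Sp : 0 < S by rewrite lt_def Sn.
rewrite mulrAC mulrA ler_pdivrMr // mulrC; apply: ler_wpM2l => //.
by apply: (le_trans IHv); exact: gsub.
Qed.

Lemma massD v : mass v = mass (false :: v) + mass (true :: v).
Proof.
rewrite /= -mulrDr -mulrDl (addrC (g (false :: v))); set S := _ + _.
have [SE|/eqP Sn] := pselect (S = 0); last by rewrite divff // mulr1.
have : g v <= 0 by rewrite -SE; exact: gsub.
have := mass_le v => h1 h2; have := le_trans h1 h2.
rewrite pmulr_lle0 // => h3; have -> : mass v = 0 by apply/le_anti; rewrite h3 mass_ge0.
by rewrite mul0r.
Qed.

Fixpoint node_at (y : R) (n : nat) : seq bool :=
  if n is m.+1 then
    (left_end (node_at y m) + mass (false :: node_at y m) <= y) :: node_at y m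
  else [::].

Definition branch (y : R) : cantor := fun n =>
  left_end (node_at y n) + mass (false :: node_at y n) <= y.

Lemma pre_branch y n : pre (branch y) n = node_at y n.
Proof. by elim: n => //= n ->. Qed.

Lemma node_at_itv y n : 0 <= y <= 1 ->
  left_end (node_at y n) <= y <= left_end (node_at y n) + mass (node_at y n).
Proof.
move=> y01; elim: n => [|n IHn]; first by rewrite /= add0r.
rewrite [node_at _ _.+1]/=; set v := node_at y n in IHn *.
case/andP: IHn => h1 h2; rewrite (massD v) in h2.
have [hy|hy] := leP (left_end v + mass (false :: v)) y.
  by rewrite [left_end (_ :: _)]/= hy /= -addrA h2.
by rewrite [left_end (_ :: _)]/= addr0 h1 ltW.
Qed.

Lemma node_at_lt y n : y < 1 -> y < left_end (node_at y n) + mass (node_at y n).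
Proof.
move=> y1; elim: n => [|n IHn]; first by rewrite /= add0r.
rewrite [node_at _ _.+1]/=; set v := node_at y n in IHn *.
rewrite (massD v) in IHn.
have [hy|hy] := leP (left_end v + mass (false :: v)) y.
  by rewrite [left_end (_ :: _)]/= -addrA.
by rewrite [left_end (_ :: _)]/= addr0.
Qed.

Lemma measurable_node_at n u : measurable [set y : R | node_at y n = u].
Proof.
elim: n u => [|n IHn] u /=.
  have [->|nu] := pselect (u = [::]).
    by rewrite (_ : [set _ | _] = setT) //; apply/seteqP; split.
  rewrite (_ : [set _ | _] = set0) //; apply/seteqP; split => // y /= h.
  by apply: nu; rewrite h.
case: u => [|b v].
  by rewrite (_ : [set _ | _] = set0) //; apply/seteqP; split.
pose t := left_end v + mass (false :: v).
rewrite (_ : [set _ | _] = [set y | node_at y n = v] `&` 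
   (if b then `[t, +oo[%classic else `]-oo, t[%classic)).
  by apply: measurableI; [exact: IHn|case: (b)].
apply/seteqP; split => y /=.
  case=> hb nv; rewrite nv -/t in hb; split=> //; move: hb.
  by case: b => hb; rewrite /= in_itv /= ?andbT // ltNge hb.
case=> nv; rewrite nv -/t; case: b => /=; rewrite in_itv /= ?andbT => h; first by rewrite h.
by rewrite leNgt h.
Qed.

Lemma measurable_branch :
  measurable_fun [set: measurableTypeR R] (branch : measurableTypeR R -> cantor).
Proof.
apply: (@measurability _ _ (measurableTypeR R) cantor _ _ coordinate_sets) => //.
move=> _ [_ [i ->] <-]; rewrite setTI.
rewrite (_ : branch @^-1` _ = 
  \bigcup_(v : seq bool) [set y : R | node_at y i.+1 = true :: v]).
  apply: countable_bigcupT_measurable => [|v]; last exact: measurable_node_at.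
  exact: countableP.
apply/seteqP; split => y /=.
  by rewrite /branch => h; exists (node_at y i) => //=; rewrite h.
by move=> [v _ /= [h _]].
Qed.

Lemma uniform_prob01 (U : set R) : measurable U ->
  uniform_prob (@ltr01 R) U = lebesgue_measure (U `&` `[0, 1]).
Proof.
move=> mU; rewrite /uniform_prob integral_uniform_pdf.
under eq_integral => x.
  rewrite inE /= => -[_]; rewrite in_itv /= => x01.
  rewrite /uniform_pdf x01 subr0 invr1.
  over.
by rewrite integral_cst ?mul1e //; exact: measurableI.
Qed.

(** The push-forward of the uniform law by [branch]. A point of the half-open
    unit interval only meets nodes of positive mass, so the measure is carried by
    any Borel set that contains all branches of positive mass. *)
Lemma splitting_measure : exists mu : probability cantor R,
  (forall u, (mu (cyl u) <= (mass u)%:E)%E) /\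
  forall E : set cantor, measurable E ->
    (forall x : cantor, (forall n, 0 < mass (pre x n)) -> E x) -> mu E = 1%E.
Proof.
pose Phi : {mfun measurableTypeR R >-> cantor} :=
  HB.pack (branch : measurableTypeR R -> cantor)
    (@isMeasurableFun.Build _ _ (measurableTypeR R) cantor branch measurable_branch).
exists (distribution (uniform_prob (@ltr01 R)) Phi); split.
  move=> u; change (uniform_prob (@ltr01 R) (branch @^-1` cyl u) <= (mass u)%:E)%E.
  have pE : branch @^-1` cyl u = [set y : R | node_at y (size u) = u].
    by apply/seteqP; split => y; rewrite /= /cyl /= pre_branch.
  rewrite pE uniform_prob01; last exact: measurable_node_at.
  apply: (@le_trans _ _ (lebesgue_measure `[left_end u, left_end u + mass u]%classic)).
    apply: le_measure; rewrite ?inE //.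
      by apply: measurableI => //; exact: measurable_node_at.
    move=> y [/= yu]; rewrite !in_itv /= => y01.
    by have := node_at_itv (size u) y01; rewrite yu.
  rewrite lebesgue_measure_itv /=; case: ifPn => _; last by rewrite lee_fin mass_ge0.
  by rewrite -EFinD addrC addKr.
move=> E mE hE; apply/eqP; rewrite eq_le probability_le1 //=.
change (1 <= uniform_prob (@ltr01 R) (branch @^-1` E))%E.
rewrite uniform_prob01; last first.
  by rewrite -[X in measurable X]setTI; exact: measurable_branch.
have -> : 1%E = lebesgue_measure (`[0%R, 1%R[%classic : set R).
  by rewrite lebesgue_measure_itv /= lte01 sube0.
apply: le_measure; rewrite ?inE //.
  apply: measurableI => //.
  by rewrite -[X in measurable X]setTI; exact: measurable_branch.
move=> y; rewrite /= !in_itv /= => /andP[y0 y1]; split; last by rewrite y0 ltW.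
apply: hE => n; rewrite pre_branch.
have yy : 0 <= y <= 1 by rewrite y0 ltW.
have /andP[h1 _] := node_at_itv n yy.
have := node_at_lt n y1; rewrite -subr_gt0 => h2.
lra.
Qed.

End unit_interval_splitting.

(** Applied to the limits of the contents of compact truncations within a
    cylinder, the splitting construction gives a measure that vanishes on
    cylinders missing some truncation. It is therefore carried by the
    intersection of the truncations, a subset of [E]. *)
Theorem frostman_cantor (R : realType) (w : nat -> R) (E : set cantor) :
  (forall n, 0 <= w n) -> measurable E -> (0 < net_content w E)%E ->
  exists (C : R) (mu : probability cantor R), [/\ 0 < C, mu E = 1%E &
    forall u, (mu (cyl u) <= (C * w (size u))%:E)%E].
Proof.
move=> w0 mE ME0; have [T [Tm ET]] := suslin_measurable mE.
(* Any positive level below the content would do; it keeps the infimum of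
   the contents of the truncations positive. *)
pose c := fine (net_content w E) / 2.
have fE : (fine (net_content w E))%:E = net_content w E.
  by rewrite fineK //; exact: net_content_fin_num.
have fE0 : 0 < fine (net_content w E) by rewrite -lte_fin fE.
have c0 : 0 < c by rewrite divr_gt0.
have cE : (c%:E < net_content w [set x | exists s, forall n, T n s x])%E.
  by rewrite -ET -fE lte_fin /c; lra.
have [b hb] := exists_truncation_bounds w0 cE.
pose K := truncation T b.
pose m k u := fine (net_content w (K k `&` cyl u)).
have mE' k u : (m k u)%:E = net_content w (K k `&` cyl u).
  by rewrite fineK //; exact: net_content_fin_num.
have m0 k u : 0 <= m k u by rewrite -lee_fin mE'; exact: net_content_ge0.
pose g u := inf [set m k u | k in setT].
have hi u : has_inf [set m k u | k in setT].
  split; first by exists (m 0%N u), 0%N.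
  by exists 0 => _ [k _ <-].
have gle k u : g u <= m k u by apply: (ge_inf (hi u).2); exists k.
have gge u x : (forall k, x <= m k u) -> x <= g u.
  by move=> h; apply: (lb_le_inf (hi u).1) => _ [k _ <-].
have g0 u : 0 <= g u by apply: gge.
have mmono k l u : (k <= l)%N -> m l u <= m k u.
  move=> kl; rewrite -lee_fin !mE'; apply: net_content_sub.
  by apply: setSI; exact: truncation_sub.
have gsub v : g v <= g (true :: v) + g (false :: v).
  rewrite -lerBlDr; apply: (gge) => k; rewrite lerBlDr addrC -lerBlDr.
  apply: gge => l; rewrite lerBlDr addrC; apply: (le_trans (gle (maxn k l) v)).
  apply: (@le_trans _ _ (m (maxn k l) (true :: v) + m (maxn k l) (false :: v))).
    rewrite -lee_fin EFinD !mE'.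
    apply: le_trans (net_contentU w0 _ _); apply: net_content_sub.
    move=> x [Kx vx]; rewrite /cyl /=.
    have h : x (size v) :: pre x (size v) = x (size v) :: v by rewrite vx.
    by case: (x (size v)) h => h; [left|right].
  by apply: lerD; apply: mmono; rewrite ?leq_maxl ?leq_maxr.
have groot : c <= g [::].
  apply: gge => k; rewrite -lee_fin mE' ltW //.
  rewrite (_ : _ `&` _ = K k); first exact: hb.
  by apply/seteqP; split => x //; case.
have gr0 := lt_le_trans c0 groot.
have [mu [hmu1 hmu2]] := splitting_measure g0 gsub gr0.
exists (g [::])^-1, mu; split; first by rewrite invr_gt0.
  apply: hmu2 => // x hx; rewrite ET; apply: bigcap_truncation => //.
  move=> k _; have gk : 0 < g (pre x k).
    apply: (lt_le_trans _ (mass_le g0 gsub (pre x k))).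
    by apply: mulr_gt0 => //; exact: hx.
  have mk := lt_le_trans gk (gle k (pre x k)).
  have [[z [Kz xz]]|nz] := pselect (exists z, (K k `&` cyl (pre x k)) z); last first.
    have h : K k `&` cyl (pre x k) = set0.
      by apply/seteqP; split => z // hz; apply: nz; exists z.
    have : ((m k (pre x k))%:E <= 0)%E.
      rewrite mE' h; apply: (le_trans (@net_content_le_weight _ w set0 _ _)) => //.
      by rewrite /weight esum_set0.
    by rewrite lee_fin leNgt mk.
  apply: (truncation_agree Tm _ Kz).
  move: xz; rewrite /cyl /= size_pre.
  clear; elim: k => // k IHk /= [h1 /IHk h2] i; rewrite ltnS leq_eqVlt.
  by move=> /orP[/eqP -> //|]; exact: h2.
move=> u; apply: (le_trans (hmu1 u)); rewrite lee_fin mulrC ler_pdivlMr //.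
apply: (le_trans (mass_le g0 gsub u)); apply: (le_trans (gle 0%N u)).
rewrite -lee_fin mE'; apply: net_content_cyl => //; exact: subIsetr.
Qed.

(** * Dyadic codes of points and Frostman measures for cells *)

Section dyadic_powers.
Context {R : realType}.

Definition dyadic (n : nat) : R := 2^-1 ^+ n.

Lemma dyadic_gt0 n : 0 < dyadic n.
Proof. by rewrite exprn_gt0. Qed.

Lemma dyadicM n : dyadic n * 2 ^+ n = 1.
Proof. by rewrite -exprMn mulVf // expr1n. Qed.

Lemma dyadic_small (e : R) : 0 < e -> exists k, dyadic k < e.
Proof.
move=> e0; exists (Num.truncn e^-1).+1.
have h : e^-1 < 2 ^+ (Num.truncn e^-1).+1.
  apply: (lt_le_trans (truncnS_gt e^-1)).
  by rewrite -natrX ler_nat ltnW // ltn_expl.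
rewrite /dyadic exprVn -[ltRHS]invrK ltf_pV2 ?posrE ?invr_gt0 // exprn_gt0.
Qed.

Lemma truncn_dyadic (x : R) : 0 <= x -> (Num.truncn (x * 2))./2 = Num.truncn x.
Proof.
move=> x0; apply/esym/truncn_def.
have x20 : 0 <= x * 2 by rewrite mulr_ge0.
have /andP[h1 h2] := truncn_itv x20.
have e := odd_double_half (Num.truncn (x * 2)).
have : (Num.truncn (x * 2))%:R = (odd (Num.truncn (x * 2)))%:R +
  (Num.truncn (x * 2))./2%:R * 2 :> R.
  by rewrite -[in LHS]e natrD -muln2 natrM.
set k := (Num.truncn (x * 2))./2; set b := odd _ => E.
rewrite -(natr1 (Num.truncn (x * 2))) in h2.
rewrite E in h1 h2; rewrite -(natr1 k).
have : (b%:R : R) = 0 \/ (b%:R : R) = 1 by case: (b); [right|left].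
by case=> hb; rewrite hb in h1 h2; apply/andP; split; lra.
Qed.

End dyadic_powers.

Section cells.
Context {R : realType}.
Variable D' : nat.
Local Notation D := D'.+1.
Variable h : 'I_D -> R.
Hypothesis h01 : forall j, 0 <= h j <= 1.

(** Coordinate [j] is resolved up to [2 ^ (- n * h j)] at level [n]. Integer
    exponents make the cells of successive levels nested. *)
Definition expo (j : 'I_D) (n : nat) : nat := Num.truncn (n%:R * h j).

Lemma expo0 j : expo j 0 = 0%N.
Proof. by rewrite /expo mul0r truncn0. Qed.

Lemma expo_succ j n : expo j n.+1 = expo j n \/ expo j n.+1 = (expo j n).+1.
Proof.
have /andP[h0 h1] := h01 j.
have n0 : 0 <= n%:R * h j by rewrite mulr_ge0.
have le1 : (expo j n <= expo j n.+1)%N.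
  by apply: le_truncn; rewrite ler_wpM2r // ler_nat.
have le2 : (expo j n.+1 <= (expo j n).+1)%N.
  rewrite /expo truncn_le_nat -(natr1 n) -[ltRHS]natr1 mulrDl mul1r.
  by apply: ltr_leD => //; exact: truncnS_gt.
have [e|ne] := eqVneq (expo j n.+1) (expo j n); first by left.
by right; apply/eqP; rewrite eqn_leq le2 ltn_neqAle le1 eq_sym ne.
Qed.

Definition cell (p : 'I_D -> R) (n : nat) (j : 'I_D) : nat :=
  Num.truncn (p j * 2 ^+ expo j n).

(** Level [n] of the grid contributes a block of [D] digits. When the exponent of
    a coordinate does not change between two levels, its digit is repeated rather
    than skipped, so that all blocks have the same length. *)
Definition code (p : 'I_D -> R) (l : nat) : bool :=
  odd (cell p (l %/ D).+1 (inord (l %% D))).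

Definition unit_point (p : 'I_D -> R) := forall j, 0 <= p j < 1.

Lemma cell0 p j : unit_point p -> cell p 0 j = 0%N.
Proof.
by move=> /(_ j) h'; rewrite /cell expo0 mulr1; apply: truncn_def.
Qed.

Lemma cell_itv p n j : 0 <= p j ->
  (cell p n j)%:R * dyadic (expo j n) <= p j <
  ((cell p n j)%:R + 1) * dyadic (expo j n).
Proof.
move=> pj; have h0 := dyadic_gt0 (R := R) (expo j n); have hM := dyadicM (R := R) (expo j n).
have pp : 0 <= p j * 2 ^+ expo j n by rewrite mulr_ge0 // exprn_ge0.
have := truncn_itv pp; rewrite -/(cell p n j) -(natr1 (cell p n j)) => /andP[h1 h2].
have e : p j = p j * 2 ^+ expo j n * dyadic (expo j n).
  by rewrite -mulrA (mulrC _ (dyadic _)) hM mulr1.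
by rewrite e ler_pM2r // ltr_pM2r // h1 h2.
Qed.

Lemma cell_pred p n j : 0 <= p j ->
  cell p n j = (if expo j n.+1 == expo j n then cell p n.+1 j
                else (cell p n.+1 j)./2).
Proof.
move=> pj; rewrite /cell; have [->|->] := expo_succ j n; first by rewrite eqxx.
rewrite gtn_eqF // exprS mulrCA (mulrC 2) truncn_dyadic //.
by rewrite mulr_ge0 // exprn_ge0.
Qed.

Lemma cell_succ p n j : 0 <= p j ->
  cell p n.+1 j = (if expo j n.+1 == expo j n then cell p n j
                   else odd (cell p n.+1 j) + (cell p n j).*2)%N.
Proof.
move=> pj; rewrite (cell_pred n pj).
by have [//|_] := eqVneq (expo j n.+1) (expo j n); rewrite odd_double_half.
Qed.

Lemma code_digit p n (j : 'I_D) : code p (n * D + j) = odd (cell p n.+1 j).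
Proof.
rewrite /code divnMDl // divn_small // addn0 modnMDl modn_small //.
by rewrite inord_val.
Qed.

(** The cell at level [n + 1] is determined by the cell at level [n] and one more
    digit per coordinate; at level [0] all cells of the unit cube agree. *)
Lemma cell_eq_of_code p q n : unit_point p -> unit_point q ->
  agree (n * D) (code p) (code q) -> forall j, cell p n j = cell q n j.
Proof.
move=> up uq; elim: n => [|n IHn] pq j; first by rewrite !cell0.
have p0 : 0 <= p j by have /andP[] := up j.
have q0 : 0 <= q j by have /andP[] := uq j.
have {}IHn : cell p n j = cell q n j.
  by apply: IHn; apply: agree_sub pq; rewrite leq_mul2r leqnSn orbT.
rewrite (cell_succ n p0) (cell_succ n q0) IHn -!code_digit pq //.
by rewrite mulSn addnC ltn_add2r.
Qed.

Lemma cell_eq_sub p q n m : unit_point p -> unit_point q -> (m <= n)%N ->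
  (forall j, cell p n j = cell q n j) -> forall j, cell p m j = cell q m j.
Proof.
move=> up uq; elim: n => [|n IHn]; first by rewrite leqn0 => /eqP ->.
rewrite leq_eqVlt => /orP[/eqP -> //|mn] pq; apply: (IHn mn) => j.
have p0 : 0 <= p j by have /andP[] := up j.
have q0 : 0 <= q j by have /andP[] := uq j.
by rewrite (cell_pred n p0) (cell_pred n q0) pq.
Qed.

(** A finer cell determines all coarser ones, and each digit is the parity of a
    cell index. *)
Lemma code_eq_of_cell p q n : unit_point p -> unit_point q ->
  (forall j, cell p n j = cell q n j) -> agree (n * D) (code p) (code q).
Proof.
move=> up uq pq l ln; rewrite /code; congr odd.
by apply: (cell_eq_sub up uq _ pq); rewrite ltn_divLR // mulnC mulnC.
Qed.

Lemma pre_agree x y n : agree n x y <-> pre x n = pre y n.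
Proof.
split; elim: n => //= n IHn.
  by move=> xy; rewrite xy // IHn //; exact: agree_sub xy.
by move=> [xy /IHn h'] i; rewrite ltnS leq_eqVlt => /orP[/eqP -> //|]; exact: h'.
Qed.

Section decode.
Variable j0 : 'I_D.
Hypothesis hj0 : h j0 = 1.

Lemma expo_j0 n : expo j0 n = n.
Proof. by rewrite /expo hj0 mulr1 natrK. Qed.

(** Reads the digits of the coordinate [j0] only, which represents time and has
    exponent one, so that none of its digits is repeated. *)
Fixpoint time_index (x : cantor) (n : nat) : nat :=
  if n is m.+1 then (x (m * D + j0)%N + (time_index x m).*2)%N else 0%N.

Lemma time_index_code p n : unit_point p -> time_index (code p) n = cell p n j0.
Proof.
move=> up; have p0 : 0 <= p j0 by have /andP[] := up j0.
elim: n => [|n IHn]; first by rewrite cell0.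
by rewrite (cell_succ n p0) !expo_j0 gtn_eqF //= IHn code_digit.
Qed.

(** On codes the sequence is the binary expansion of the time and increases to
    it; the supremum makes sense, and is measurable, on the whole Cantor space. *)
Definition decode (x : cantor) : R :=
  sups (fun n => (time_index x n)%:R * dyadic n) 0.

Lemma time_index_bound x n : (time_index x n)%:R * dyadic n <= 1 :> R.
Proof.
rewrite -[leRHS](dyadicM (R := R) n) mulrC; apply: ler_wpM2l; first exact/ltW/dyadic_gt0.
rewrite -natrX ler_nat; apply: ltnW.
elim: n => //= n IHn; rewrite expnS mul2n -ltn_half_double.
by rewrite half_bit_double.
Qed.

Lemma decode_ubound x : has_ubound (range (fun n => (time_index x n)%:R * dyadic n : R)).
Proof. by exists 1 => _ [n _ <-]; exact: time_index_bound. Qed.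

Lemma decode_ge x n : (time_index x n)%:R * dyadic n <= decode x.
Proof.
apply: ub_le_sup; last by exists n.
exact/has_ubound_sdrop/decode_ubound.
Qed.

Lemma decode_code p : unit_point p -> decode (code p) = p j0.
Proof.
move=> up; have p0 : 0 <= p j0 by have /andP[] := up j0.
apply/eqP; rewrite eq_le; apply/andP; split.
  apply: ge_sup; first by exists ((time_index (code p) 0)%:R * dyadic 0); exists 0%N.
  move=> _ [n _ <-]; rewrite time_index_code //.
  by have /andP[] := cell_itv n p0; rewrite expo_j0.
apply/ler_addgt0Pr => e /dyadic_small[k ke].
have /andP[_] := cell_itv k p0; rewrite expo_j0 mulrDl mul1r => h1.
have := decode_ge (code p) k; rewrite time_index_code // => h2.
lra.
Qed.

Lemma measurable_coordinate i : measurable [set x : cantor | x i = true].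
Proof. by apply: sub_sigma_algebra; exists i. Qed.

Lemma measurable_cyl u : measurable (cyl u : set cantor).
Proof.
elim: u => [|b v IHv].
  by rewrite (_ : cyl _ = setT) //; apply/seteqP; split.
rewrite (_ : cyl _ = cyl v `&` (if b then [set x | x (size v) = true] 
   else ~` [set x | x (size v) = true])).
  apply: measurableI => //; case: b; first exact: measurable_coordinate.
  by apply: measurableC; exact: measurable_coordinate.
apply/seteqP; split=> x; rewrite /cyl /=.
  by move=> [xb xv]; split => //; move: xb; case: b => //= ->.
by move=> [-> ]; case: b => /= [->//|/negP/negbTE ->].
Qed.

Lemma measurable_time_index n k : measurable [set x : cantor | time_index x n = k].
Proof.
elim: n k => [|n IHn] k /=.
  have [->|nk] := pselect (k = 0%N).
    by rewrite (_ : [set _ | _] = setT) //; apply/seteqP; split.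
  rewrite (_ : [set _ | _] = set0) //; apply/seteqP; split => // x /= hk.
  by apply: nk; rewrite hk.
rewrite (_ : [set _ | _] = [set x | time_index x n = k./2] `&`
   (if odd k then [set x | x (n * D + j0)%N = true] 
    else ~` [set x | x (n * D + j0)%N = true])).
  apply: measurableI => //; case: odd; first exact: measurable_coordinate.
  by apply: measurableC; exact: measurable_coordinate.
apply/seteqP; split=> x /=.
  move=> <-; rewrite half_bit_double oddD odd_double addbF oddb; split => //.
  by case e: (x (n * D + j0)%N) => /=; rewrite e.
case=> ->; rewrite -[X in _ = X]odd_double_half.
by case: odd => /= [->//|/negP/negbTE ->].
Qed.

Lemma measurable_decode : measurable_fun setT (decode : cantor -> measurableTypeR R).
Proof.
apply: (@measurable_fun_sups _ cantor R setT (fun n x => (time_index x n)%:R * dyadic n)).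
  by move=> x _; exact: decode_ubound.
move=> n; apply: measurable_funM => //.
move=> _ Y mY; rewrite setTI.
rewrite (_ : _ @^-1` _ = \bigcup_(k in [set k : nat | Y k%:R])
    [set x : cantor | time_index x n = k]).
  by apply: bigcup_measurable => k _; exact: measurable_time_index.
apply/seteqP; split=> x /=; first by move=> Yx; exists (time_index x n).
by move=> [k Yk ->].
Qed.

Section codes.
Variables (G : set R) (pt : R -> 'I_D -> R).
Hypothesis mG : measurable G.
Hypothesis upt : forall t, G t -> unit_point (pt t).
Hypothesis mpt : forall j, measurable_fun G (fun t => pt t j).
Hypothesis timept : forall t, G t -> pt t j0 = t.

Definition codes : set cantor := [set x | exists2 t, G t & x = code (pt t)].

Lemma measurable_cell n j k : measurable (G `&` [set t | cell (pt t) n j = k]).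
Proof.
rewrite (_ : _ `&` _ = G `&` (fun t => pt t j) @^-1`
   `[k%:R * dyadic (expo j n), (k%:R + 1) * dyadic (expo j n)[).
  exact: mpt.
apply/seteqP; split=> t [Gt] /=; have /andP[p0 _] := upt Gt j; rewrite in_itv /=.
  by move=> <-; split => //; exact: cell_itv.
move=> hk; split => //; apply: truncn_def; move: hk.
have h0 := dyadic_gt0 (R := R) (expo j n); have hM := dyadicM (R := R) (expo j n).
have e : pt t j = pt t j * 2 ^+ expo j n * dyadic (expo j n).
  by rewrite -mulrA (mulrC _ (dyadic _)) hM mulr1.
by rewrite {1 2}e ler_pM2r // ltr_pM2r // natr1.
Qed.

(** The set of codes is the image of [G] under a Borel injection. A Borel left
    inverse turns this into a description by countably many Borel conditions. *)
Lemma codesE : codes = [set x | G (decode x) /\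
  forall l, code (pt (decode x)) l = x l].
Proof.
apply/seteqP; split=> x /=.
  by move=> [t Gt ->]; rewrite decode_code ?timept //; exact: upt.
by move=> [Gx hx]; exists (decode x) => //; apply/funext => l; rewrite hx.
Qed.

Lemma measurable_codes : measurable codes.
Proof.
have mdec : forall A : set R, measurable A -> measurable (decode @^-1` A : set cantor).
  by move=> A mA; rewrite -[X in measurable X]setTI; exact: measurable_decode.
have mcode l : measurable (G `&` [set t | code (pt t) l = true]).
  rewrite (_ : _ `&` _ = \bigcup_(k in [set k | odd k])
     (G `&` [set t | cell (pt t) (l %/ D).+1 (inord (l %% D)) = k])).
    by apply: bigcup_measurable => k _; exact: measurable_cell.
  apply/seteqP; split=> t /=; rewrite /code.
    by move=> [Gt ok]; exists (cell (pt t) (l %/ D).+1 (inord (l %% D))).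
  by move=> [k /= ok [Gt ->]].
rewrite codesE (_ : [set _ | _] = \bigcap_l
   ((decode @^-1` (G `&` [set t | code (pt t) l = true]) `&` [set x | x l = true])
   `|` (decode @^-1` (G `\` (G `&` [set t | code (pt t) l = true])) `\`
     [set x | x l = true]))).
  apply: bigcapT_measurable => l; apply: measurableU.
    by apply: measurableI; [exact: mdec|exact: measurable_coordinate].
  apply: measurableD; last exact: measurable_coordinate.
  by apply: mdec; apply: measurableD.
apply/seteqP; split=> x /=.
  move=> [Gx hx] l _; have := hx l; case e: (x l) => hl; [left|right] => //=.
  by split; [split=> //; case; rewrite hl|rewrite e].
move=> hx; split; first by have := hx 0%N I; case=> /= [[[]]//|[[]]//].
move=> l; have := hx l I; case=> /= [[[_ ->] ->]//|[[Gx nc] nx]].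
by case: (x l) nx => // _; apply/negbTE/negP => hc; apply: nc.
Qed.

(** The measure is the image under [decode] of a Frostman measure on the set of
    codes. All codes of points in one cell of level [n] lie in one cylinder of
    level [n * D]. *)
Theorem cell_frostman (v : nat -> R) : (forall n, 0 <= v n) ->
  (0 < net_content (fun l => v (l %/ D)%N) codes)%E ->
  exists (C : R) (nu : probability (measurableTypeR R) R),
   [/\ 0 < C, nu G = 1%E & forall n (kappa : 'I_D -> nat),
     (nu (G `&` [set t | forall j, cell (pt t) n j = kappa j]) <= (C * v n)%:E)%E].
Proof.
move=> v0 hc.
have [C [mu [C0 muE muC]]] := frostman_cantor (fun l => v0 _) measurable_codes hc.
pose dec : {mfun cantor >-> measurableTypeR R} :=
  HB.pack (decode : cantor -> measurableTypeR R)
    (@isMeasurableFun.Build _ _ cantor (measurableTypeR R) decode measurable_decode).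
have mdec : forall A : set R, measurable A -> measurable (decode @^-1` A : set cantor).
  by move=> A mA; rewrite -[X in measurable X]setTI; exact: measurable_decode.
exists C, (distribution mu dec); split => //.
  change (mu (decode @^-1` G) = 1%E).
  apply/eqP; rewrite eq_le probability_le1 /=; last exact: mdec.
  rewrite -muE.
  apply: le_measure; rewrite ?inE; [exact: measurable_codes|exact: mdec|].
  by rewrite codesE => x [].
move=> n kappa; set B := _ `&` _.
have mB : measurable B.
  rewrite /B (_ : _ `&` _ = \bigcap_(j : 'I_D) (G `&` [set t | cell (pt t) n j = kappa j])).
    apply: fin_bigcap_measurable => // j _; exact: measurable_cell.
  apply/seteqP; split=> t /=; first by move=> [Gt ht] j _; split.
  by move=> ht; split=> [|j]; [case: (ht j0 I)|case: (ht j I)].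
change (mu (decode @^-1` B) <= (C * v n)%:E)%E.
have mE := measurable_codes.
have -> : mu (decode @^-1` B) = mu (decode @^-1` B `&` codes).
  have mdB := mdec _ mB.
  rewrite -[in LHS](setIT (decode @^-1` B)) -(setUv codes) setIUr measureU //.
  - rewrite [X in (_ + X)%E](_ : _ = 0%E) ?adde0 //; apply/eqP.
    rewrite eq_le measure_ge0 andbT.
    have <- : mu (~` codes) = 0%E.
      by rewrite probability_setC // muE subee.
    by apply: le_measure; rewrite ?inE;
      [apply: measurableI => //; exact: measurableC|exact: measurableC|exact: subIsetr].
  - exact: measurableI.
  - by apply: measurableI => //; exact: measurableC.
  - by apply/seteqP; split => // x [[_ h1] [_ h2]].
have [[x0 [Bx0 cx0]]|nx] := pselect (exists x, (decode @^-1` B `&` codes) x); last first.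
  rewrite (_ : _ `&` _ = set0) ?measure0 ?lee_fin ?mulr_ge0 // ?ltW //.
  by apply/seteqP; split => // x hx; apply: nx; exists x.
have := muC (pre x0 (n * D)); rewrite size_pre mulnK // => {}muC.
apply: (le_trans _ muC); apply: le_measure; rewrite ?inE.
- by apply: measurableI => //; exact: mdec.
- exact: measurable_cyl.
- move=> x [Bx cx]; rewrite /cyl /= size_pre; apply/pre_agree.
  move: Bx Bx0; case: cx => t Gt ->; case: cx0 => s Gs ->.
  rewrite /= !decode_code ?timept //; [|exact: upt|exact: upt].
  move=> [_ ht] [_ hs]; apply: code_eq_of_cell; [exact: upt|exact: upt|].
  by move=> j; rewrite ht hs.
Qed.

End codes.
End decode.
End cells.

(** * Parabolic content against net content *)

Section parabolic_content_theory.
Context {R : realType} {d : nat}.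
Variables (H beta : R).
Hypothesis beta0 : 0 < beta.
Implicit Types F : set (R * 'rV[R]_d).

Lemma parabolic_content_ge0 F : (0 <= parabolic_content H beta F)%E.
Proof.
apply: le_ereal_inf_tmp => _ [a [b [delta [_ _ ->]]]].
by apply: nneseries_ge0 => n _ _; rewrite lee_fin powR_ge0.
Qed.

Lemma parabolic_content_sub F F' : F `<=` F' ->
  (parabolic_content H beta F <= parabolic_content H beta F')%E.
Proof.
move=> FF'; apply: le_ereal_inf_tmp => _ [a [b [delta [h1 h2 ->]]]].
apply: ereal_inf_lbound; exists a, b, delta; split => //.
exact: subset_trans h2.
Qed.

(** Covers in the definition of the content are sequences. A family indexed by a
    countable type is turned into a sequence padded with boxes of side zero,
    which cost nothing since [0 < beta]. *)
Lemma parabolic_content_countable_cover (I : countType) (C : set I) F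
    (a : I -> R) (b : I -> 'rV[R]_d) (delta : I -> R) :
  (forall i, C i -> 0 <= delta i) ->
  F `<=` \bigcup_(i in C) parabolic_box H (a i) (b i) (delta i) ->
  (parabolic_content H beta F <= \esum_(i in C) (delta i `^ beta)%:E)%E.
Proof.
move=> d0 FC.
pose pick j : option I :=
  if pickle_inv j is Some i then if `[< C i >] then Some i else None else None.
have pickK i : C i -> pick (pickle i) = Some i.
  by move=> Ci; rewrite /pick pickleK_inv asboolT.
pose a' j := if pick j is Some i then a i else 0.
pose b' j := if pick j is Some i then b i else 0.
pose delta' j := if pick j is Some i then delta i else 0.
have d0' j : 0 <= delta' j.
  rewrite /delta' /pick; case: pickle_inv => // i.
  by case: ifPn => // /asboolP; exact: d0.
apply: (@le_trans _ _ (\sum_(0 <= j <oo) (delta' j `^ beta)%:E)%E).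
  apply: ereal_inf_lbound; exists a', b', delta'; split => //.
  move=> p /FC[i Ci pi]; exists (pickle i) => //.
  by rewrite /a' /b' /delta' pickK.
rewrite nneseries_esumT; last by move=> n; rewrite lee_fin powR_ge0.
have -> : (\esum_(i in C) (delta i `^ beta)%:E =
    \esum_(i in C) (delta' (pickle i) `^ beta)%:E)%E.
  by apply: eq_esum => i Ci; rewrite /delta' pickK.
rewrite -(@esum_image _ _ _ C pickle (fun j => (delta' j `^ beta)%:E)); last first.
  by move=> x y _ _; exact: (pcan_inj pickleK_inv).
rewrite [X in (_ <= X)%E]esum_mkcond; apply: le_esum => j _.
case: ifPn => // jC; rewrite /delta' /pick.
case e : pickle_inv => [i|]; last by rewrite powR0 // gt_eqF.
case: ifPn => [/asboolP Ci|_]; last by rewrite powR0 // gt_eqF.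
exfalso; move/negP: jC; apply; rewrite inE; exists i => //.
by have := pickle_invK (T := I) j; rewrite e.
Qed.

(** The usual countable subadditivity, needed for null sets only. *)
Lemma parabolic_content_bigcup_null (F : nat -> set (R * 'rV[R]_d)) :
  (forall k, parabolic_content H beta (F k) = 0%E) ->
  parabolic_content H beta (\bigcup_k F k) = 0%E.
Proof.
move=> F0; apply/eqP; rewrite eq_le parabolic_content_ge0 andbT.
apply/lee_addgt0Pr => e e0; rewrite add0e.
have hk k : exists x : (nat -> R) * (nat -> 'rV[R]_d) * (nat -> R),
    [/\ forall j, 0 <= x.2 j,
        F k `<=` \bigcup_j parabolic_box H (x.1.1 j) (x.1.2 j) (x.2 j) &
        (\esum_(j in [set: nat]) (x.2 j `^ beta)%:E <= (e / (2 ^ k.+1)%:R)%:E)%E].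
  have ek : 0 < e / (2 ^ k.+1)%:R :> R by rewrite divr_gt0 // ltr0n expn_gt0.
  have : parabolic_content H beta (F k) \is a fin_num by rewrite F0.
  move=> /(lb_ereal_inf_adherent ek)[_ [a [b [delta [h1 h2 ->]]]]].
  have := F0 k; rewrite /parabolic_content => ->; rewrite add0e => h3.
  exists (a, b, delta); split => //=; rewrite -nneseries_esumT; first exact: ltW.
  by move=> n; rewrite lee_fin powR_ge0.
have [x hx] := choice hk.
apply: (@le_trans _ _ (\esum_(kj in [set: nat * nat])
    ((x kj.1).2 kj.2 `^ beta)%:E)%E).
  apply: (@parabolic_content_countable_cover (nat * nat)%type setT _
    (fun kj => (x kj.1).1.1 kj.2) (fun kj => (x kj.1).1.2 kj.2)
    (fun kj => (x kj.1).2 kj.2)).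
    by move=> [k j] _; have [h _ _] := hx k; exact: h.
  move=> p [k _ Fp]; have [_ h _] := hx k; have [j _ pj] := h p Fp.
  by exists (k, j).
have -> : [set: nat * nat] = [set: nat] `*`` (fun=> [set: nat]).
  by apply/seteqP; split.
rewrite -(@esum_esum _ _ _ setT (fun=> setT) (fun k j => ((x k).2 j `^ beta)%:E)); last first.
  by move=> k j _ _; rewrite lee_fin powR_ge0.
apply: (@le_trans _ _ (\esum_(k in [set: nat]) (e / (2 ^ k.+1)%:R)%:E)%E).
  by apply: le_esum => k _; have [] := hx k.
rewrite -nneseries_esumT; first exact: (epsilon_trick0 xpredT (ltW e0)).
by move=> n; rewrite lee_fin divr_ge0 // ltW.
Qed.

Lemma parabolic_content_point (p : R * 'rV[R]_d) : parabolic_content H beta [set p] = 0%E.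
Proof.
apply/eqP; rewrite eq_le parabolic_content_ge0 andbT.
apply: (le_trans (@parabolic_content_countable_cover unit setT [set p]
  (fun=> p.1) (fun=> p.2) (fun=> 0) _ _)).
- by [].
- move=> _ ->; exists tt => //; split; first by rewrite addr0 lexx.
  by move=> i; rewrite lexx /= lerDl powR_ge0.
- by rewrite esum1 // => i _; rewrite powR0 // gt_eqF.
Qed.

End parabolic_content_theory.

Section localisation.
Context {R : realType} {d : nat}.
Variables (H beta : R).
Hypotheses (beta0 : 0 < beta).
Variables (f : R -> 'rV[R]_d) (A : set R).
Hypothesis hA : A `<=` `[0, 1].

Definition local_part (m : {ffun 'I_d -> int}) : set R :=
  A `&` [set t | t < 1 /\ forall i, (m i)%:~R <= f t ord0 i < (m i)%:~R + 1].

(** The graph over the times in question is the countable union of its parts in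
    unit cubes with integer corners, up to the single point above [t = 1]. *)
Lemma exists_local_part : (0 < parabolic_content H beta (graph A f))%E ->
  exists m, (0 < parabolic_content H beta (graph (local_part m) f))%E.
Proof.
move=> h; apply: contrapT => /forallNP hm.
(* Index [0] is the point above [t = 1], and index [k + 1] the unit cube
   coded by [k]. *)
pose F (k : nat) := if k is k'.+1 then
   if unpickle k' is Some m then graph (local_part m) f else set0
   else [set (1, f 1)].
have F0 k : parabolic_content H beta (F k) = 0%E.
  case: k => [|k] /=; first exact: parabolic_content_point.
  have G0 m : parabolic_content H beta (graph (local_part m) f) = 0%E.
    apply/eqP; rewrite eq_le parabolic_content_ge0 andbT leNgt.
    exact/negP.
  case: unpickle => [m|]; first exact: G0.
  apply/eqP; rewrite eq_le parabolic_content_ge0 andbT.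
  by rewrite -(parabolic_content_point H beta0 (1, f 1)); apply: parabolic_content_sub.
have := parabolic_content_bigcup_null beta0 F0.
have : graph A f `<=` \bigcup_k F k.
  move=> _ [t At <-].
  have [->|t1] := eqVneq t 1; first by exists 0%N.
  pose m := [ffun i => Num.floor (f t ord0 i)] : {ffun 'I_d -> int}.
  exists (pickle m).+1 => //=; rewrite pickleK; exists t => //; split => //; split.
    have := hA At; rewrite /= in_itv /= => /andP[_ ht1].
    by rewrite lt_neqAle t1.
  move=> i; rewrite ffunE; have := floor_itv (f t ord0 i).
  by rewrite intrD.
move=> /(parabolic_content_sub H beta) hs h0; move: hs; rewrite h0.
by rewrite leNgt h.
Qed.

End localisation.

Section graph_codes.
Context {R : realType} {d : nat}.
Variables (H beta : R).
Hypotheses (H01 : 0 < H < 1) (beta0 : 0 < beta).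
Variables (f : R -> 'rV[R]_d) (G : set R) (m : 'I_d -> R).
Hypothesis G01 : forall t, G t -> 0 <= t < 1.
Hypothesis Gf : forall t, G t -> forall i, m i <= f t ord0 i < m i + 1.

(** The coordinate [ord0] is time. *)
Definition scaling (j : 'I_d.+1) : R := if unlift ord0 j is Some _ then H else 1.

Definition graph_point (t : R) (j : 'I_d.+1) : R :=
  if unlift ord0 j is Some i then f t ord0 i - m i else t.

Lemma scaling01 j : 0 <= scaling j <= 1.
Proof.
rewrite /scaling; case: unlift => [_|]; last by rewrite ler01 lexx.
by case/andP: H01 => h0 h1; rewrite !ltW.
Qed.

Lemma scaling_time : scaling ord0 = 1.
Proof. by rewrite /scaling unlift_none. Qed.

Lemma scaling_space i : scaling (lift ord0 i) = H.
Proof. by rewrite /scaling liftK. Qed.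

Lemma graph_point_time t : graph_point t ord0 = t.
Proof. by rewrite /graph_point unlift_none. Qed.

Lemma graph_point_space t i : graph_point t (lift ord0 i) = f t ord0 i - m i.
Proof. by rewrite /graph_point liftK. Qed.

Lemma graph_point_unit t : G t -> unit_point (graph_point t).
Proof.
move=> Gt j; rewrite /graph_point; case: unlift => [i|]; last exact: G01.
by have /andP[h1 h2] := Gf Gt i; rewrite subr_ge0 h1 ltrBlDl.
Qed.

Lemma dyadic_powR n : dyadic n = 2 `^ (- n%:R) :> R.
Proof. by rewrite powRN powR_mulrn // /dyadic exprVn. Qed.

(** Rounding the exponent down enlarges the sides of a cell by a factor at most
    two, which is absorbed in a box whose side in time is larger by [2 `^ H^-1]. *)
Lemma dyadic_expo_le n i :
  dyadic (expo scaling (lift ord0 i) n) <= (2 `^ H^-1 * dyadic n) `^ H :> R.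
Proof.
have /andP[H0 H1] := H01.
rewrite powRM ?powR_ge0 ?(ltW (dyadic_gt0 _)) // -powRrM mulVf ?gt_eqF // powRr1 //.
rewrite !dyadic_powR -powRrM mulNr -[X in X * _](@powRr1 _ 2) // -powRD ?pnatr_eq0 ?implybT //.
apply: ler_powR; first by rewrite ler1n.
have : n%:R * H < (expo scaling (lift ord0 i) n).+1%:R.
  by rewrite /expo scaling_space truncnS_gt.
rewrite -(natr1 (expo scaling (lift ord0 i) n)) => h; lra.
Qed.

Lemma dyadic_expo_ge n i : dyadic n `^ H <= dyadic (expo scaling (lift ord0 i) n) :> R.
Proof.
have /andP[H0 H1] := H01.
rewrite !dyadic_powR -powRrM mulNr; apply: ler_powR; first by rewrite ler1n.
rewrite lerN2 /expo scaling_space truncn_le mulr_ge0 //; exact: ltW.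
Qed.

(** A cylinder that meets the codes determines a cell, and this cell is contained
    in a parabolic box of comparable side. A cover of the codes by cylinders thus
    yields a cover of the graph whose cost is larger by a constant factor only. *)
Lemma net_content_codes_gt0 : (0 < parabolic_content H beta (graph G f))%E ->
  (0 < net_content (fun l => (dyadic (l %/ d.+1) `^ beta)%R) (codes scaling G graph_point))%E.
Proof.
have /andP[H0 H1] := H01.
move=> h; rewrite lt_neqAle net_content_ge0 ?andbT; last by move=> n; exact: powR_ge0.
apply/eqP => /esym hc; move: h; rewrite ltNge => /negP; apply.
pose K := (2 `^ H^-1) `^ beta : R.
have K0 : 0 < K by rewrite !powR_gt0.
apply/lee_addgt0Pr => e e0; rewrite add0e.
have w0 l : 0 <= dyadic (l %/ d.+1) `^ beta :> R by exact: powR_ge0.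
have [C [_ hC wC]] := net_content_adherent w0 (codes scaling G graph_point) (divr_gt0 e0 K0).
rewrite hc add0e in wC.
(* Only the nodes that meet the codes have a cell to be covered. *)
pose C' := [set u | C u /\ exists2 t, G t & cyl u (code scaling (graph_point t))].
have [tt htt] : {tt : seq bool -> R & forall u, C' u -> G (tt u) /\
    cyl u (code scaling (graph_point (tt u)))}.
  apply: (@choice _ _ (fun u t => C' u -> G t /\ cyl u (code scaling (graph_point t)))) => u.
  have [[_ [t Gt ut]]|nu] := pselect (C' u); first by exists t.
  by exists 0.
pose lev (u : seq bool) := (size u %/ d.+1)%N.
pose kap u := cell scaling (graph_point (tt u)) (lev u).
pose a u := (kap u ord0)%:R * dyadic (lev u) : R.
pose b u := \row_i (m i + (kap u (lift ord0 i))%:R *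
    dyadic (expo scaling (lift ord0 i) (lev u))) : 'rV[R]_d.
pose delta u := 2 `^ H^-1 * dyadic (lev u) : R.
have delta0 u : 0 <= delta u by rewrite mulr_ge0 ?powR_ge0 ?(ltW (dyadic_gt0 _)).
apply: (@le_trans _ _ (\esum_(u in C') (delta u `^ beta)%:E)%E).
  apply: (parabolic_content_countable_cover beta0 (a := a) (b := b)) => // p [t Gt <-].
  have [u Cu ut] := hC (code scaling (graph_point t)) (ex_intro2 _ _ t Gt erefl).
  have C'u : C' u by split => //; exists t.
  have [Gs us] := htt u C'u.
  have cE : forall j, cell scaling (graph_point t) (lev u) j = kap u j.
    apply: (cell_eq_of_code scaling01); [exact: graph_point_unit|exact: graph_point_unit|].
    apply: (@agree_sub _ _ (size u)); first exact: leq_trunc_div.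
    by apply/pre_agree; move: ut us; rewrite /cyl /= => -> ->.
  have ci j : 0 <= graph_point t j by have /andP[] := graph_point_unit Gt j.
  exists u => //; split => /=.
    have := cell_itv scaling (lev u) (ci ord0).
    rewrite cE graph_point_time (expo_j0 scaling_time) mulrDl mul1r -/(a u).
    move=> /andP[-> /ltW h2] /=; apply: (le_trans h2); rewrite lerD2l.
    rewrite -[leLHS]mul1r; apply: ler_wpM2r; first exact/ltW/dyadic_gt0.
    rewrite -[leLHS](powRr0 2); apply: ler_powR; first by rewrite ler1n.
    by rewrite invr_ge0 ltW.
  move=> i; rewrite mxE; have := cell_itv scaling (lev u) (ci (lift ord0 i)).
  rewrite cE graph_point_space mulrDl mul1r => /andP[h1 h2].
  have := dyadic_expo_le (lev u) i; rewrite -/(delta u) => h3.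
  by apply/andP; split; lra.
apply: (@le_trans _ _ (\esum_(u in C) (K%:E * (dyadic (lev u) `^ beta)%:E))%E).
  apply: (@le_trans _ _ (\esum_(u in C') (K%:E * (dyadic (lev u) `^ beta)%:E))%E).
    apply: le_esum => u _; rewrite -EFinM lee_fin /delta powRM ?powR_ge0 //.
    exact/ltW/dyadic_gt0.
  apply: ge_ereal_sup => _ [X [finX XC] <-]; apply: ereal_sup_ubound.
  by exists X => //; split => // u /XC[].
have -> : (\esum_(u in C) (K%:E * (dyadic (lev u) `^ beta)%:E) =
   K%:E * \esum_(u in C) (dyadic (lev u) `^ beta)%:E)%E.
  rewrite /esum -ereal_sup_pZl //.
  have hX (X : set (seq bool)) : (\sum_(x \in X) (K%:E * (dyadic (lev x) `^ beta)%:E) =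
      K%:E * \sum_(x \in X) (dyadic (lev x) `^ beta)%:E)%E.
    by rewrite ge0_mule_fsumr // => u; rewrite lee_fin powR_ge0.
  congr ereal_sup; apply/seteqP; split=> [_ [X XC <-]|_ [_ [X XC <-] <-]] /=.
    by exists (\sum_(x \in X) (dyadic (lev x) `^ beta)%:E)%E; [exists X|rewrite hX].
  by exists X => //; rewrite hX.
apply: (@le_trans _ _ (K%:E * (e / K)%:E)%E).
  by apply: lee_wpmul2l => //; rewrite lee_fin ltW.
by rewrite -EFinM mulrC divfK ?gt_eqF.
Qed.

End graph_codes.

(** * Densities and moments of normal laws *)

Section normal_law.
Context {R : realType}.
Local Notation leb := (@lebesgue_measure R).

(** The law is defined by its density, and the Radon-Nikodym derivative agrees
    with that density almost everywhere. *)
Lemma ge0_integral_normal_prob (m s : R) (f : R -> \bar R) : s != 0 ->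
  measurable_fun setT f -> (forall x, 0 <= f x)%E ->
  (\int[normal_prob m s]_x f x = \int[leb]_x (f x * (normal_pdf m s x)%:E))%E.
Proof.
move=> s0 mf f0; have dom := normal_prob_dominates m s.
rewrite -(Radon_Nikodym_SigmaFinite.change_of_variables dom) //.
have mpdf : measurable_fun setT (fun x => (normal_pdf m s x)%:E).
  by apply/measurable_EFinP; exact: measurable_normal_pdf.
have iRN := Radon_Nikodym_SigmaFinite.f_integrable dom.
apply: ae_eq_integral => //.
- by apply: emeasurable_funM => //; exact: measurable_int iRN.
- exact: emeasurable_funM.
- apply: ae_eqe_mul2l; apply: integral_ae_eq => // E _ mE.
  by rewrite -Radon_Nikodym_SigmaFinite.f_integral.
Qed.

Lemma normal_peak_le (s : R) : s != 0 -> normal_peak s <= `|s|^-1.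
Proof.
move=> s0; rewrite /normal_peak lef_pV2 ?posrE ?normr_gt0 //; last first.
  by rewrite sqrtr_gt0 pmulrn_lgt0 // mulr_gt0 ?pi_gt0 // exprn_even_gt0.
rewrite -sqrtr_sqr ler_wsqrtr // -mulrnAr ler_peMr ?sqr_ge0 //.
by have := pi_ge2 R; rewrite mulr2n; lra.
Qed.

Lemma normal_prob_itv_le (m s a b K : R) : s != 0 -> a <= b -> 0 <= K ->
  (forall y, a <= y <= b -> normal_pdf m s y <= K) ->
  (normal_prob m s `[a, b] <= (K * (b - a))%:E)%E.
Proof.
move=> s0 ab K0 hK; rewrite /normal_prob.
apply: (@le_trans _ _ (\int[leb]_(x in `[a, b]) K%:E)%E).
  apply: ge0_le_integral => //=.
  - by move=> x _; rewrite lee_fin normal_pdf_ge0.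
  - by apply/measurable_EFinP/measurable_funTS; exact: measurable_normal_pdf.
rewrite integral_cst //= lebesgue_measure_itv /=.
case: ifPn => [_|]; first by rewrite -EFinD -EFinM.
by rewrite mule0 lee_fin mulr_ge0 // subr_ge0.
Qed.

(** With [u = (x - m) ^+ 2 / (4 * s ^+ 2)], the bound [u * expR (- u) <= 1]
    trades the square for the density of a normal law whose standard deviation is
    larger by [Num.sqrt 2]. The constant [8] is not sharp. *)
Lemma normal_second_moment_le (m s : R) : s != 0 ->
  (\int[normal_prob m s]_x ((x - m) ^+ 2)%:E <= (8 * s ^+ 2)%:E)%E.
Proof.
move=> s0; rewrite ge0_integral_normal_prob //; last 2 first.
- apply/measurable_EFinP; apply: measurable_funX; exact: measurable_funB.
- by move=> x; rewrite lee_fin sqr_ge0.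
have s20 : 0 < s ^+ 2 by rewrite exprn_even_gt0.
pose s' := Num.sqrt 2 * s.
have s'E : s' ^+ 2 = 2 * s ^+ 2 by rewrite exprMn sqr_sqrtr.
have s'0 : s' != 0 by rewrite mulf_neq0 // sqrtr_eq0 -ltNge.
have peakE : normal_peak s <= 2 * normal_peak s'.
  rewrite /normal_peak (_ : s' ^+ 2 * pi *+ 2 = 2 * (s ^+ 2 * pi *+ 2)); last first.
    by rewrite s'E -!mulrnAr mulrA.
  rewrite (@sqrtrM _ 2) // invfM mulrA.
  apply: ler_peMl; first by rewrite invr_ge0 sqrtr_ge0.
  rewrite -[leLHS](@divff _ (Num.sqrt 2)) ?sqrtr_eq0 -?ltNge //.
  apply: ler_wpM2r; first by rewrite invr_ge0 sqrtr_ge0.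
  rewrite -[leRHS](@ger0_norm _ 2) // -sqrtr_sqr ler_wsqrtr //; lra.
have bound x : (x - m) ^+ 2 * normal_pdf m s x <= 8 * s ^+ 2 * normal_pdf m s' x.
  rewrite /normal_pdf (negbTE s0) (negbTE s'0) /normal_fun s'E.
  set q := (x - m) ^+ 2; have q0 : 0 <= q by exact: sqr_ge0.
  set u := q / (4 * s ^+ 2).
  have u0 : 0 <= u by rewrite divr_ge0 // mulr_ge0 // ltW.
  have qE : q = 4 * s ^+ 2 * u.
    by rewrite /u mulrC divfK // gt_eqF // mulr_gt0.
  have -> : - q / (s ^+ 2 *+ 2) = - (u + u).
    rewrite /u -(mulr_natr (s ^+ 2)); by field.
  have -> : - q / ((2 * s ^+ 2) *+ 2) = - u.
    rewrite /u -(mulr_natr (2 * _)); by field.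
  rewrite qE opprD expRD.
  have ue : u * expR (- u) <= 1.
    rewrite expRN ler_pdivrMr ?expR_gt0 // mul1r.
    by apply: le_trans (expR_ge1Dx u); rewrite lerDr.
  rewrite (_ : 4 * s ^+ 2 * u * (normal_peak s * (expR (- u) * expR (- u))) =
    (4 * s ^+ 2 * expR (- u)) * (normal_peak s * (u * expR (- u)))); last by ring.
  rewrite (_ : 8 * s ^+ 2 * (normal_peak s' * expR (- u)) =
    (4 * s ^+ 2 * expR (- u)) * (2 * normal_peak s')); last by ring.
  apply: ler_wpM2l; first by rewrite mulr_ge0 ?expR_ge0 // mulr_ge0 ?sqr_ge0.
  apply: le_trans peakE; rewrite -[leRHS]mulr1.
  by apply: ler_wpM2l => //; exact: normal_peak_ge0.
apply: (@le_trans _ _ (\int[leb]_x ((8 * s ^+ 2)%:E * (normal_pdf m s' x)%:E))%E).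
  apply: ge0_le_integral => //.
  - by move=> x _; rewrite mule_ge0 // lee_fin ?sqr_ge0 ?normal_pdf_ge0.
  - apply: emeasurable_funM; apply/measurable_EFinP; last exact: measurable_normal_pdf.
    by apply: measurable_funX; exact: measurable_funB.
  - apply/emeasurable_funM => //; apply/measurable_EFinP; exact: measurable_normal_pdf.
  - by move=> x _; rewrite -!EFinM lee_fin.
rewrite ge0_integralZl //.
- by rewrite integral_normal_pdf mule1.
- by apply/measurable_EFinP; exact: measurable_normal_pdf.
- by move=> x _; rewrite lee_fin normal_pdf_ge0.
- by rewrite lee_fin mulr_ge0 ?sqr_ge0.
Qed.

End normal_law.

(** * Interval probabilities of centered Gaussian variables *)

Lemma ler_sqr2 (R : realType) (x y : R) : 0 <= x -> x <= y -> x ^+ 2 <= y ^+ 2.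
Proof. by move=> x0 xy; apply: lerXn2r; rewrite // nnegrE (le_trans x0). Qed.

Section centered_gaussian.
Context {d : measure_display} {T : measurableType d} {R : realType}.
Variable P : probability T R.
Variables (Y : T -> R) (sigma : R).
Hypothesis mY : measurable_fun setT Y.
Hypothesis gY : gaussian_variable P Y.
Hypothesis EY : (\int[P]_w (Y w)%:E = 0)%E.
Hypothesis EY2 : (\int[P]_w (Y w ^+ 2)%:E = (sigma ^+ 2)%:E)%E.
Hypothesis sigma0 : 0 < sigma.

Lemma square_integrable : P.-integrable setT (EFin \o (fun w => Y w ^+ 2)).
Proof.
apply/integrableP; split; first by apply/measurable_EFinP; exact: measurable_funX.
under eq_integral do rewrite /= ger0_norm ?sqr_ge0 //.
by rewrite /= EY2 ltry.
Qed.

Lemma integrable_of_square : P.-integrable setT (EFin \o Y).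
Proof.
apply: (@le_integrable _ _ _ P setT measurableT (EFin \o Y)
  ((EFin \o cst 1%R) \+ (EFin \o (fun w => Y w ^+ 2)%R))%E).
- exact/measurable_EFinP.
- move=> w _; rewrite /= lee_fin.
  rewrite [leRHS]ger0_norm ?addr_ge0 ?sqr_ge0 // ler_norml.
  have := sqr_ge0 (Y w + 1); have := sqr_ge0 (Y w - 1).
  by rewrite !expr2 => h1 h2; apply/andP; split; nra.
- apply: integrableD => //; last exact: square_integrable.
  exact: finite_measure_integrable_cst.
Qed.

Lemma second_moment_about (m : R) :
  (\int[P]_w ((Y w - m) ^+ 2)%:E = (sigma ^+ 2 + m ^+ 2)%:E)%E.
Proof.
have iY := integrable_of_square; have iY2 := square_integrable.
have ic := finite_measure_integrable_cst P (m ^+ 2) measurableT.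
have iZ : P.-integrable setT (EFin \o (fun w => - (2 * m) * Y w)).
  apply: (eq_integrable measurableT (fun w => (- (2 * m))%:E * (EFin \o Y) w)%E) => //.
  exact: integrableZl.
transitivity (\int[P]_w ((EFin \o (fun w => Y w ^+ 2)%R) w +
   ((EFin \o (fun w => - (2 * m) * Y w)%R) \+ (EFin \o cst (m ^+ 2)%R)) w))%E.
  by apply: eq_integral => w _ /=; rewrite -!EFinD; congr EFin; ring.
have iZc := integrableD measurableT iZ ic.
rewrite integralD //.
rewrite integralD // EY2 /= integral_cst //.
rewrite [X in (_ + (_ + _ * X))%E](_ : _ = 1%E); last exact: probability_setT.
rewrite mule1.
under [X in (_ + (X + _))%E]eq_integral do rewrite EFinM.
by rewrite integralZl // EY mule0 add0e EFinD.
Qed.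

(** A Gaussian law is only known up to unknown parameters. Its mean zero and its
    variance are compared with them through the second moment about [m], which
    equals [sigma ^+ 2 + m ^+ 2]; this also excludes the degenerate law. *)
Lemma gaussian_parameters : exists m s : R,
  [/\ s != 0, forall E : set R, measurable E -> P (Y @^-1` E) = normal_prob m s E &
      sigma ^+ 2 + m ^+ 2 <= 8 * s ^+ 2].
Proof.
have [m [s lawY]] := gY; exists m, s.
pose Y' : {mfun T >-> measurableTypeR R} :=
  HB.pack (Y : T -> measurableTypeR R)
    (@isMeasurableFun.Build _ _ T (measurableTypeR R) Y mY).
have mf : measurable_fun [set: R] (fun x : R => ((x - m) ^+ 2)%:E).
  by apply/measurable_EFinP; apply: measurable_funX; exact: measurable_funB.
have h := second_moment_about m.
have tr : (\int[P]_w ((Y w - m) ^+ 2)%:E =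
    \int[distribution P Y']_x ((x - m) ^+ 2)%:E)%E.
  rewrite ge0_integral_distribution // => x; by rewrite lee_fin sqr_ge0.
rewrite tr in h.
have [s0|s0] := eqVneq s 0.
  exfalso; have hd : (\int[distribution P Y']_x ((x - m) ^+ 2)%:E = 
      \int[dirac (m : measurableTypeR R)]_x ((x - m) ^+ 2)%:E)%E.
    apply: eq_measure_integral => A mA _; have := lawY A mA.
    by rewrite /gaussian_law s0 eqxx.
  move: h; rewrite hd integral_dirac // subrr expr0n /= mule0 => -[].
  by apply/eqP; rewrite lt_eqF // ltr_pwDl ?sqr_ge0 // exprn_gt0.
have lawY' E : measurable E -> P (Y @^-1` E) = normal_prob m s E.
  by move=> mE; rewrite lawY // /gaussian_law (negbTE s0).
split=> //; rewrite -lee_fin -h.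
rewrite (eq_measure_integral (normal_prob m s)) => [|A mA _]; last exact: lawY'.
exact: normal_second_moment_le.
Qed.

Lemma chebyshev_centered :
  ((3 / 4)%:E <= P (Y @^-1` `[(- (2 * sigma))%R, (2 * sigma)%R]))%E.
Proof.
have sg0 := sigma0.
set I := `[- (2 * sigma), 2 * sigma]%classic.
have mI : measurable (Y @^-1` I).
  by rewrite -[X in measurable X]setTI; apply: mY => //; exact: measurable_itv.
have h : ((4 * sigma ^+ 2)%:E * P (~` (Y @^-1` I)) <= (sigma ^+ 2)%:E)%E.
  rewrite -EY2 -integral_cst ?setIT //; last exact: measurableC.
  apply: (@le_trans _ _ (\int[P]_(x in ~` (Y @^-1` I)) (Y x ^+ 2)%:E)%E).
    apply: ge0_le_integral => //.
    - exact: measurableC.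
    - by move=> x _; rewrite lee_fin mulr_ge0 ?sqr_ge0.
    - apply/measurable_EFinP/measurable_funTS; exact: measurable_funX.
    - move=> x; rewrite /I /= in_itv /= => /negP.
      rewrite lee_fin negb_and -!ltNge => /orP[] hx.
        have : (2 * sigma) ^+ 2 <= (- Y x) ^+ 2.
          by apply: ler_sqr2; rewrite ?mulr_ge0 ?(ltW sigma0) // lerNr ltW.
        by rewrite exprMn sqrrN -natrX.
      have : (2 * sigma) ^+ 2 <= (Y x) ^+ 2.
        by apply: ler_sqr2; rewrite ?mulr_ge0 ?(ltW sigma0) // ltW.
      by rewrite exprMn -natrX.
  apply: ge0_subset_integral => //; first exact: measurableC.
  - apply/measurable_EFinP; exact: measurable_funX.
  - by move=> x _; rewrite lee_fin sqr_ge0.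
rewrite probability_setC // in h.
have fP : P (Y @^-1` I) \is a fin_num by exact: fin_num_measure.
move: h; rewrite -(fineK fP) -EFinB -EFinM !lee_fin => h.
have s2 : 0 < sigma ^+ 2 by exact: exprn_gt0.
set p := fine _ in h *.
have : 4 * (1 - p) <= 1.
  by rewrite -(ler_pM2l s2) mulr1 mulrCA mulrA.
lra.
Qed.

(** The first two bounds come from the second moment about [m]. For the last one,
    by Chebyshev's inequality an interval of length [4 * sigma] has probability
    at least [3 / 4], whereas the density is at most [`|s|^-1]. *)
Lemma gaussian_parameters_bounds : exists m s : R,
  [/\ s != 0, forall E : set R, measurable E -> P (Y @^-1` E) = normal_prob m s E,
      `|m| <= 3 * `|s|, sigma <= 3 * `|s| & `|s| <= 6 * sigma].
Proof.
have sg0 := sigma0.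
have [m [s [s0 lawY hs]]] := gaussian_parameters; exists m, s.
have a0 : 0 < `|s| by rewrite normr_gt0.
have sq x : x ^+ 2 <= 8 * s ^+ 2 -> `|x| <= 3 * `|s|.
  move=> hx; rewrite -(ler_pXn2r (n := 2)) ?nnegrE ?mulr_ge0 //.
  rewrite exprMn !real_normK ?num_real //; have := sqr_ge0 s; lra.
split => //.
- by apply: sq; have := sqr_ge0 sigma; lra.
- by rewrite -[leLHS]gtr0_norm //; apply: sq; have := sqr_ge0 m; lra.
- have := chebyshev_centered; rewrite lawY // => h.
  have ab : - (2 * sigma) <= 2 * sigma by lra.
  have pk y : normal_pdf m s y <= `|s|^-1.
    by apply: le_trans (normal_pdf_ub m y s0) _; exact: normal_peak_le.
  have i0 : 0 <= `|s|^-1 by rewrite invr_ge0.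
  have := le_trans h (normal_prob_itv_le s0 ab i0 (fun y _ => pk y)).
  by rewrite lee_fin [leRHS]mulrC ler_pdivlMr // => h2; lra.
Qed.

Lemma gaussian_itv_le (a r : R) : 0 <= r ->
  (P (Y @^-1` `[(a - r)%R, (a + r)%R]) <= (6 * r / sigma)%:E)%E.
Proof.
have sg0 := sigma0.
move=> r0; have [m [s [s0 lawY _ hs _]]] := gaussian_parameters_bounds.
have a0 : 0 < `|s| by rewrite normr_gt0.
have ab : a - r <= a + r by lra.
have pk y : normal_pdf m s y <= `|s|^-1.
  by apply: le_trans (normal_pdf_ub m y s0) _; exact: normal_peak_le.
have i0 : 0 <= `|s|^-1 by rewrite invr_ge0.
rewrite lawY //; apply: (le_trans (normal_prob_itv_le s0 ab i0 (fun y _ => pk y))).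
rewrite lee_fin mulrC ler_pdivrMr // mulrAC ler_pdivlMr //.
have := ler_wpM2l r0 hs; lra.
Qed.

(** If the unknown mean [m] is small compared to [eta], the interval stays at
    distance [eta / 2] from it and the density is exponentially small there.
    Otherwise [sigma] is at least of the order of [eta], and the exponential
    factor is harmless. *)
Lemma gaussian_tail_itv_le (a r eta : R) : 0 < eta -> eta <= `|a| -> 0 <= r ->
    r <= eta / 4 ->
  (P (Y @^-1` `[(a - r)%R, (a + r)%R]) <=
   (6 * r / sigma * (expR 18 * expR (- (eta ^+ 2 / (288 * sigma ^+ 2)))))%:E)%E.
Proof.
have sg0 := sigma0.
move=> eta0 aeta r0 reta.
have [m [s [s0 lawY hm hs hs']]] := gaussian_parameters_bounds.
have a0 : 0 < `|s| by rewrite normr_gt0.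
have s2 : s ^+ 2 = `|s| ^+ 2 by rewrite real_normK ?num_real.
have s20 : 0 < `|s| ^+ 2 by exact: exprn_gt0.
have sg20 : 0 < sigma ^+ 2 by exact: exprn_gt0.
have ss : `|s| ^+ 2 <= 36 * sigma ^+ 2.
  by have := ler_sqr2 (normr_ge0 s) hs'; rewrite exprMn -natrX.
have k0 : 0 < 288 * sigma ^+ 2 by rewrite mulr_gt0 // ltr0n.
set g := expR 18 * _.
have g0 : 0 <= g by rewrite mulr_ge0 ?expR_ge0.
have ab : a - r <= a + r by lra.
have i0 : 0 <= `|s|^-1 * g by rewrite mulr_ge0 ?invr_ge0.
have pk y : a - r <= y <= a + r -> normal_pdf m s y <= `|s|^-1 * g.
  move=> /andP[y1 y2].
  (* In the first case [eta <= 4 * `|m| <= 12 * `|s| <= 72 * sigma] and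
     [72 ^ 2 = 18 * 288]; in the second one [288 = 8 * 6 ^ 2] comes from
     [`|s| <= 6 * sigma]. *)
  have [mbig|msmall] := leP (eta / 4) `|m|.
    apply: (le_trans (normal_pdf_ub m y s0)); apply: (le_trans (normal_peak_le s0)).
    apply: ler_peMr; first by rewrite invr_ge0.
    rewrite /g -expRD -[leLHS]expR0 ler_expR subr_ge0 ler_pdivrMr //.
    have h1 : eta <= 72 * sigma by lra.
    apply: (le_trans (ler_sqr2 (ltW eta0) h1)).
    have -> : (72 * sigma) ^+ 2 = 18 * (288 * sigma ^+ 2) by ring.
    exact: lexx.
  rewrite /normal_pdf (negbTE s0); apply: ler_pM.
  - exact: normal_peak_ge0.
  - exact: normal_fun_ge0.
  - exact: normal_peak_le.
  rewrite /normal_fun /g; apply: (@le_trans _ _ (expR (- (eta ^+ 2 / (288 * sigma ^+ 2))))).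
    rewrite ler_expR mulNr lerN2.
    have h1 : eta / 2 <= `|y - m|.
      have : `|a| <= `|y - m| + `|a - y| + `|m|.
        have e : a = (y - m) + (a - y) + m by ring.
        rewrite {1}e; apply: (le_trans (ler_normD _ _)); rewrite lerD2r.
        exact: ler_normD.
      have : `|a - y| <= r by rewrite ler_norml; apply/andP; split; lra.
      lra.
    have h2 : eta ^+ 2 / 4 <= (y - m) ^+ 2.
      rewrite -(@real_normK _ (y - m)) ?num_real //.
      have -> : eta ^+ 2 / 4 = (eta / 2) ^+ 2 by rewrite exprMn exprVn -natrX.
      by apply: ler_sqr2; lra.
    rewrite ler_pdivrMr //.
    rewrite mulrAC ler_pdivlMr; last by rewrite s2 pmulrn_lgt0.
    rewrite s2 -mulr_natr.
    have h3 := ler_wpM2l (sqr_ge0 eta) ss.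
    have h4 := ler_wpM2r (ltW sg20) h2.
    lra.
  apply: ler_peMl; first exact: expR_ge0.
  by rewrite -[leLHS]expR0 ler_expR.
rewrite lawY //; apply: (le_trans (normal_prob_itv_le s0 ab i0 pk)).
rewrite lee_fin; have -> : a + r - (a - r) = 2 * r by ring.
rewrite mulrAC; apply: ler_wpM2r => //.
rewrite mulrC ler_pdivrMr // mulrAC ler_pdivlMr //.
have := ler_wpM2l r0 hs; lra.
Qed.

End centered_gaussian.

(** One term of the exponential series at [u ^+ 2 / K]. *)
Lemma expRN_le_power (R : realType) (K : R) (n : nat) (u : R) : 1 <= K -> 0 < u ->
  expR (- (u ^+ 2 / K)) <= (n`!%:R * K ^+ n) * u ^- n.
Proof.
move=> K1 u0; have K0 : 0 < K by exact: lt_le_trans K1.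
have c1 : 1 <= n`!%:R * K ^+ n.
  rewrite -[leLHS]mulr1; apply: ler_pM => //; last exact: exprn_ege1.
  by rewrite ler1n fact_gt0.
have [u1|u1] := leP u 1.
  apply: (@le_trans _ _ 1).
    by rewrite -[leRHS]expR0 ler_expR oppr_le0 divr_ge0 ?sqr_ge0 // ltW.
  rewrite -[leLHS]mulr1; apply: ler_pM => //.
  by rewrite invf_ge1 ?exprn_gt0 //; apply: exprn_ile1 => //; exact: ltW.
have x0 : 0 < u ^+ 2 / K by rewrite divr_gt0 // exprn_gt0.
have h : (u ^+ 2 / K) ^+ n / n`!%:R <= expR (u ^+ 2 / K).
  case: n c1 => [|n] _.
    by rewrite expr0 fact0 divr1 -[leLHS]expR0 ler_expR ltW.
  by apply: le_trans (expR_ge1Dxn n (ltW x0)); rewrite lerDr.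
have p0 : 0 < (u ^+ 2 / K) ^+ n / n`!%:R by rewrite divr_gt0 // ?exprn_gt0 // ltr0n fact_gt0.
rewrite expRN; apply: (@le_trans _ _ ((u ^+ 2 / K) ^+ n / n`!%:R)^-1).
  by rewrite lef_pV2 ?posrE ?expR_gt0.
rewrite invfM invrK expr_div_n invf_div mulrC -mulrA; apply: ler_wpM2l => //.
apply: ler_wpM2l; first by rewrite exprn_ge0 // ltW.
have un0 : 0 < u ^+ n by exact: exprn_gt0.
rewrite -exprM mul2n -addnn exprD lef_pV2 ?posrE ?mulr_gt0 //.
by apply: ler_peMr; [exact: ltW|apply: exprn_ege1; exact: ltW].
Qed.

(** * Small ball probabilities of fractional Brownian increments *)

Section fBm_increment.
Context {disp : measure_display} {T : measurableType disp} {R : realType}.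
Variable P : probability T R.
Variables (H : R) (I : set R) (X : R -> {RV P >-> R}).
Hypothesis H0 : 0 < H.
Hypothesis hX : is_fBm1 H I X.

Lemma fBm_second_moment t : I t ->
  (\int[P]_w (X t w ^+ 2)%:E = ((`|t| `^ H) ^+ 2)%:E)%E.
Proof.
move=> It; have [_ _ /(_ t t It It)] := hX; rewrite unlock.
under eq_integral do rewrite -expr2.
move=> ->; congr EFin; rewrite subrr normr0 powR0; last by rewrite mulf_neq0 ?gt_eqF.
rewrite subr0 -powR_mulrn ?powR_ge0 // -powRrM (mulrC H).
by field.
Qed.

Lemma fBm_integrable t : I t -> P.-integrable setT (EFin \o X t).
Proof. by move=> It; apply: integrable_of_square (fBm_second_moment It). Qed.

Lemma fBm_increment_mean s t : I s -> I t ->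
  (\int[P]_w (X s w - X t w)%:E = 0)%E.
Proof.
move=> Is It; have [_ hE _] := hX.
have := hE s Is; have := hE t It; rewrite !unlock => ht hs.
transitivity (\int[P]_w ((EFin \o X s) w - (EFin \o X t) w))%E => //.
rewrite integralB //; try exact: fBm_integrable.
by rewrite /= ht hs sube0.
Qed.

Lemma fBm_increment_variance s t : I s -> I t ->
  (\int[P]_w ((X s w - X t w) ^+ 2)%:E = ((`|s - t| `^ H) ^+ 2)%:E)%E.
Proof.
move=> Is It; have [_ _ /(_ s t Is It)] := hX; rewrite unlock => hst.
have is2 := square_integrable (measurable_funPT (X s)) (fBm_second_moment Is).
have it2 := square_integrable (measurable_funPT (X t)) (fBm_second_moment It).
have ist : P.-integrable setT (EFin \o (fun w => X s w * X t w)).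
  apply: (@le_integrable _ _ _ P setT measurableT _
   ((EFin \o (fun w => X s w ^+ 2)%R) \+ (EFin \o (fun w => X t w ^+ 2)%R))%E).
  - by apply/measurable_EFinP; apply: measurable_funM.
  - move=> w _; rewrite /= lee_fin [leRHS]ger0_norm ?addr_ge0 ?sqr_ge0 //.
    rewrite ler_norml; have := sqr_ge0 (X s w + X t w); have := sqr_ge0 (X s w - X t w).
    have := sqr_ge0 (X s w); have := sqr_ge0 (X t w).
    by rewrite !expr2 => h1 h2 h3 h4; apply/andP; split; lra.
  - exact: integrableD.
have ist2 : P.-integrable setT (EFin \o (fun w => - 2 * (X s w * X t w))).
  apply: (eq_integrable measurableT (fun w => (- 2)%:E * 
    (EFin \o (fun w => X s w * X t w)%R) w)%E) => //.
  exact: integrableZl.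
have h := integrableD measurableT ist2 it2.
transitivity (\int[P]_w ((EFin \o (fun w => X s w ^+ 2)%R) w +
   ((EFin \o (fun w => - 2 * (X s w * X t w))%R) \+ (EFin \o (fun w => X t w ^+ 2)%R)) w))%E.
  by apply: eq_integral => w _ /=; rewrite -!EFinD; congr EFin; ring.
rewrite integralD // integralD //=.
rewrite (fBm_second_moment Is) (fBm_second_moment It).
under [X in (_ + (X + _))%E]eq_integral do rewrite EFinM.
rewrite integralZl // hst -EFinM -!EFinD; congr EFin.
have e (x : R) : (`|x| `^ H) ^+ 2 = `|x| `^ (2 * H).
  by rewrite -powR_mulrn ?powR_ge0 // -powRrM mulrC.
rewrite !e (distrC t s); by field.
Qed.

Lemma fBm_increment_gaussian s t : I s -> I t ->
  gaussian_variable P (fun w => X s w - X t w).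
Proof.
move=> Is It; have [gX _ _] := hX.
have := gX 2 (fun k : 'I_2 => if k == ord0 then s else t)
  (fun k : 'I_2 => if k == ord0 then 1 else -1) _.
have -> : (fun w => \sum_(k < 2) (if k == ord0 then 1 else -1) *
    X (if k == ord0 then s else t) w) = (fun w => X s w - X t w).
  by apply/funext => w; rewrite big_ord_recl big_ord1 /= mul1r mulN1r.
by apply => k; case: ifP.
Qed.

(** Independence of the coordinates is stated for the sigma-algebras generated by
    single times, and the increment is measurable for the one of its own
    coordinate. *)
Lemma fBm_increment_event s t a b : I s -> I t ->
  sigma_process I X ((fun w => X s w - X t w) @^-1` `[a, b]).
Proof.
move=> Is It.
set G := [set G | exists t (E : set R), [/\ I t, measurable E & G = X t @^-1` E]].
have mX u : I u -> measurable_fun setT (X u : g_sigma_algebraType G -> R).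
  by move=> Iu _ E mE; rewrite setTI; apply: sub_sigma_algebra; exists u, E.
have := measurable_funB (mX s Is) (mX t It).
move=> /(_ measurableT `[a, b]%classic (measurable_itv _)).
by rewrite setTI.
Qed.

End fBm_increment.

Definition small_ball_constant (R : realType) (d : nat) : R :=
  6 ^+ d * (expR 18 * (d`!%:R * 288 ^+ d)).

Lemma small_ball_constant_ge (R : realType) d : 6 ^+ d <= small_ball_constant R d.
Proof.
rewrite /small_ball_constant ler_peMr ?exprn_ge0 //.
rewrite -[leLHS]mulr1; apply: ler_pM => //; last first.
  by rewrite -natrX -natrM ler1n muln_gt0 fact_gt0 expn_gt0.
by rewrite -[leLHS]expR0 ler_expR.
Qed.

Section fBm_small_ball.
Context {disp : measure_display} {T : measurableType disp} {R : realType}.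
Variable P : probability T R.
Variables (d : nat) (H : R) (I : set R) (B : 'I_d -> R -> {RV P >-> R}).
Hypothesis H0 : 0 < H.
Hypothesis hB : is_fBm H I B.

(** With [sigma = `|s - t| `^ H], the product over the coordinates of the bounds
    for intervals is [(6 * r / sigma) ^+ d], which is enough if [eta <= sigma].
    Otherwise a coordinate with [eta <= `|a i|] contributes an exponentially
    small factor, which compensates for the [d] powers of [eta / sigma]. For
    [eta / 4 < r] the bound exceeds one. *)
Theorem fBm_small_ball s t (a : 'I_d -> R) (r eta : R) :
  I s -> I t -> s != t -> 0 < r -> 0 < eta ->
  eta <= `|s - t| `^ H \/ (exists i, eta <= `|a i|) ->
  (P [set w | forall i, a i - r <= B i s w - B i t w <= a i + r]%R <=
   (small_ball_constant R d * (r / eta) ^+ d)%:E)%E.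
Proof.
move=> Is It st r0 eta0 hyp.
pose sg := `|s - t| `^ H.
have sg0 : 0 < sg by rewrite powR_gt0 // normr_gt0 subr_eq0.
have [fB indep _] := hB.
pose Y i w := B i s w - B i t w.
have mY i : measurable_fun setT (Y i) by apply: measurable_funB.
have gY i := fBm_increment_gaussian (fB i) Is It.
have EY i := fBm_increment_mean H0 (fB i) Is It.
have EY2 i := fBm_increment_variance H0 (fB i) Is It.
pose E i := Y i @^-1` `[a i - r, a i + r].
have mE i : measurable (E i).
  by rewrite -[X in measurable X]setTI; apply: mY => //; exact: measurable_itv.
have -> : [set w | forall i, a i - r <= B i s w - B i t w <= a i + r] = \bigcap_i E i.
  apply/seteqP; split => w /= h.
    by move=> i _; rewrite /E /= in_itv /=; exact: h.
  by move=> i; have := h i Logic.I; rewrite /E /= in_itv.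
rewrite indep; last by move=> i; exact: fBm_increment_event.
pose p i := fine (P (E i)).
have pE i : P (E i) = (p i)%:E by rewrite fineK // fin_num_measure.
have p0 i : 0 <= p i by rewrite -lee_fin -pE.
have p1 i : p i <= 1 by rewrite -lee_fin -pE probability_le1.
under eq_bigr do rewrite pE.
rewrite prodEFin lee_fin.
have pA i : p i <= 6 * r / sg.
  by rewrite -lee_fin -pE; apply: (gaussian_itv_le (mY i) (gY i) (EY i) (EY2 i) sg0 _ (ltW r0)).
have q0 : 0 <= 6 * r / sg by rewrite divr_ge0 ?mulr_ge0 ?ltW.
have prod1 : \prod_(i < d) p i <= (6 * r / sg) ^+ d.
  rewrite -[X in _ ^+ X]card_ord -prodr_const; apply: ler_prod => i _.
  by rewrite p0 pA.
have re0 : 0 <= r / eta by rewrite divr_ge0 ?ltW.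
have cge := small_ball_constant_ge R d.
have le_constant x : 0 <= x -> x <= 6 * (r / eta) ->
    x ^+ d <= small_ball_constant R d * (r / eta) ^+ d.
  move=> x0 hx; apply: (@le_trans _ _ (6 ^+ d * (r / eta) ^+ d)).
    by rewrite -exprMn; apply: lerXn2r; rewrite ?nnegrE // mulr_ge0.
  by apply: ler_wpM2r => //; rewrite exprn_ge0.
have [sge|sgl] := leP eta sg.
  apply: (le_trans prod1); apply: le_constant => //.
  rewrite -mulrA; apply: ler_wpM2l => //; apply: ler_wpM2l; first exact: ltW.
  by rewrite lef_pV2.
case: hyp => [|[i0 hi0]]; first by rewrite leNgt sgl.
have [rbig|rsmall] := ltP (eta / 4) r.
  apply: (@le_trans _ _ 1).
    rewrite -[leRHS](@big1_eq _ _ (@GRing.mul R) 'I_d (index_enum 'I_d) xpredT).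
    by apply: ler_prod => i _; rewrite p0 p1.
  rewrite -[leLHS](expr1n _ d); apply: le_constant => //.
  rewrite mulrA ler_pdivlMr //; lra.
have hi : p i0 <= 6 * r / sg * (expR 18 * (d`!%:R * 288 ^+ d * (eta / sg) ^- d)).
  apply: (@le_trans _ _ (6 * r / sg * (expR 18 * expR (- (eta ^+ 2 / (288 * sg ^+ 2)))))).
    rewrite -lee_fin -pE.
    exact: (gaussian_tail_itv_le (mY i0) (gY i0) (EY i0) (EY2 i0) sg0 eta0 hi0 (ltW r0) rsmall).
  apply: ler_wpM2l => //; apply: ler_wpM2l; first exact: expR_ge0.
  have -> : eta ^+ 2 / (288 * sg ^+ 2) = (eta / sg) ^+ 2 / 288.
    by field; rewrite gt_eqF.
  by apply: expRN_le_power; [rewrite ler1n|rewrite divr_gt0].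
rewrite (bigD1 i0) //=.
apply: (@le_trans _ _ (6 * r / sg * (expR 18 * (d`!%:R * 288 ^+ d * (eta / sg) ^- d)) *
   (6 * r / sg) ^+ d.-1)).
  apply: ler_pM => //; first by apply: prodr_ge0 => i _.
  have -> : d.-1 = #|[pred i : 'I_d | i != i0]|.
    have := cardC1 i0; rewrite card_ord => <-; exact: eq_card.
  rewrite -prodr_const; apply: ler_prod => i _; by rewrite p0 pA.
rewrite mulrAC -exprS prednK; last exact: leq_ltn_trans (ltn_ord i0).
rewrite le_eqVlt; apply/orP; left; apply/eqP; rewrite /small_ball_constant.
rewrite !expr_div_n !exprMn invf_div.
field.
by rewrite !expf_eq0 !gt_eqF // !andbF.
Qed.

End fBm_small_ball.

(** * Collision mass and Lebesgue measure of an image *)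

Section grid.
Context {R : realType} {d : nat}.

Definition grid_cell (r : R) (x : 'I_d -> R) : {ffun 'I_d -> int} :=
  [ffun i => Num.floor (x i / r)].

(** In coordinate [i] a segment of length [l] meets at most [l / r + 2] intervals
    of the grid. *)
Lemma grid_cells_of_box (r : R) (a b : 'I_d -> R) : 0 < r ->
  (forall i, a i <= b i) ->
  exists Q : seq {ffun 'I_d -> int},
    (forall x, (forall i, a i <= x i <= b i) -> grid_cell r x \in Q) /\
    (size Q)%:R * r ^+ d <= \prod_(i < d) (b i - a i + 2 * r).
Proof.
move=> r0 ab.
pose lo i := Num.floor (a i / r); pose hi i := Num.floor (b i / r).
have fl (x y : R) : x <= y -> Num.floor (x / r) <= Num.floor (y / r).
  by move=> xy; apply: le_floor; rewrite ler_pM2r // invr_gt0.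
pose M i := `|hi i - lo i|%N.+1.
have ME i : (M i)%:Z = hi i - lo i + 1.
  by rewrite /M -addn1 PoszD gez0_abs // subr_ge0; exact: fl.
pose shift (g : {dffun forall i, 'I_(M i)}) : {ffun 'I_d -> int} :=
  [ffun i => lo i + (nat_of_ord (g i))%:Z].
exists (codom shift); split.
  move=> x hx; apply/codomP.
  have lt i : (`|Num.floor (x i / r) - lo i| < M i)%N.
    have /andP[h1 h2] := hx i; have := fl _ _ h1; have := fl _ _ h2.
    rewrite -/(hi i) -/(lo i) /M ltnS => h3 h4.
    by rewrite -lez_nat !gez0_abs ?subr_ge0 ?lerD2r // (le_trans h4).
  exists [ffun i => Ordinal (lt i)]; apply/ffunP => i; rewrite !ffunE /=.
  rewrite gez0_abs; first by rewrite addrCA subrr addr0.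
  by rewrite subr_ge0; have /andP[h1 _] := hx i; exact: fl.
rewrite size_codom card_dep_ffun foldrE big_image /=.
under eq_bigr do rewrite card_ord.
rewrite -[X in _ * _ ^+ X]card_ord -prodr_const natr_prod -big_split /=.
apply: ler_prod => i _; rewrite mulr_ge0 ?(ltW r0) //=.
have -> : (M i)%:R = (hi i - lo i + 1)%:~R :> R by rewrite -ME.
rewrite -ler_pdivlMr // !rmorphD rmorphN /= rmorph1.
have -> : (b i - a i + 2 * r) / r = b i / r - a i / r + 2.
  by field; rewrite gt_eqF.
have /andP[h1 _] := floor_itv (b i / r).
have /andP[_ h2] := floor_itv (a i / r).
rewrite rmorphD /= rmorph1 in h2; rewrite -/(hi i) in h1; rewrite -/(lo i) in h2.
lra.
Qed.

(** Continuity at zero of a polynomial in [r]. *)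
Lemma inflated_volume_le (I : Type) (s : seq I) (l : I -> 'I_d -> R) (e : R) :
  0 < e -> exists2 delta, 0 < delta & forall r, 0 <= r < delta ->
    \sum_(k <- s) \prod_(i < d) (l k i + 2 * r) <=
    \sum_(k <- s) \prod_(i < d) l k i + e.
Proof.
move=> e0; pose p : {poly R} := \sum_(k <- s) \prod_(i < d) ((l k i)%:P + 2%:P * 'X).
have pE r : p.[r] = \sum_(k <- s) \prod_(i < d) (l k i + 2 * r).
  rewrite /p horner_sum; apply: eq_bigr => k _; rewrite horner_prod.
  by apply: eq_bigr => i _; rewrite !hornerE.
have p0 : p.[0] = \sum_(k <- s) \prod_(i < d) l k i.
  by rewrite pE; apply: eq_bigr => k _; apply: eq_bigr => i _; rewrite mulr0 addr0.
have := @continuous_horner R p 0 => /cvgrPdist_lt /(_ e e0) [delta d0 hd].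
exists delta => // r /andP[r0 rd]; rewrite -pE -p0.
have : `|p.[0] - p.[r]| < e.
  by apply: hd; rewrite /= sub0r normrN ger0_norm.
by rewrite ltr_norml => /andP[]; lra.
Qed.

End grid.

Section measure_of_lists.
Context {d : measure_display} {T : measurableType d} {R : realType}.
Variables (mu : {measure set T -> \bar R}) (I : choiceType) (F : I -> set T).
Hypothesis mF : forall i, measurable (F i).

Lemma measure_bigsetU_seq_le (s : seq I) :
  (mu (\big[setU/set0]_(i <- s) F i) <= \sum_(i <- s) mu (F i))%E.
Proof.
elim: s => [|i s IHs]; first by rewrite !big_nil measure0.
rewrite !big_cons; apply: (le_trans (measureU2 mu (mF i) _)).
  exact: bigsetU_measurable.
exact: leeD2l.
Qed.

Lemma measure_bigsetU_seq (s : seq I) : uniq s ->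
  (forall i j, i != j -> F i `&` F j = set0) ->
  mu (\big[setU/set0]_(i <- s) F i) = (\sum_(i <- s) mu (F i))%E.
Proof.
move=> us dF; elim: s us => [|i s IHs] /=; first by rewrite !big_nil measure0.
move=> /andP[ni us]; rewrite !big_cons -IHs //; apply: measureU => //.
  exact: bigsetU_measurable.
apply/seteqP; split => // x [Fix]; rewrite -bigcup_seq => -[j /= js Fjx].
have ij : i != j by apply: contraNneq ni => ->.
by have := dF i j ij => /seteqP[h _]; apply: (h x).
Qed.

End measure_of_lists.

Section image_measure.
Context {disp : measure_display} {S : measurableType disp} {R : realType}.
Variables (nu : probability S R) (d : nat) (z : S -> 'I_d -> R).
Hypothesis mz : forall i, measurable_fun setT (fun s => z s i).

Definition same_cell (r : R) : set (S * S) :=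
  [set p | grid_cell r (z p.1) = grid_cell r (z p.2)].

Lemma measurable_grid_cell r kappa : 0 < r ->
  measurable [set s | grid_cell r (z s) = kappa].
Proof.
move=> r0.
rewrite (_ : [set _ | _] = \bigcap_(i : 'I_d) ((fun s => z s i) @^-1`
   `[(kappa i)%:~R * r, ((kappa i)%:~R + 1) * r[)).
  apply: fin_bigcap_measurable => // i _; rewrite -[X in measurable X]setTI.
  by apply: mz => //; exact: measurable_itv.
apply/seteqP; split => s /=.
  move=> /ffunP hk i _; have := hk i; rewrite ffunE /= in_itv /= => <-.
  rewrite -ler_pdivlMr // -ltr_pdivrMr //.
  by have := floor_itv (z s i / r); rewrite intrD.
move=> hk; apply/ffunP => i; rewrite ffunE; apply/floor_def.
have := hk i I; rewrite /= in_itv /=.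
by rewrite -ler_pdivlMr // -ltr_pdivrMr // intrD.
Qed.

Lemma same_cellE r : same_cell r = \bigcup_kappa
  ([set s | grid_cell r (z s) = kappa] `*` [set s | grid_cell r (z s) = kappa]).
Proof.
apply/seteqP; split=> -[s s'] /=; first by move=> h; exists (grid_cell r (z s)).
by move=> [k _ [/= h1 h2]]; rewrite /same_cell /= h1 h2.
Qed.

Lemma measurable_same_cell r : 0 < r -> measurable (same_cell r).
Proof.
move=> r0; rewrite same_cellE; apply: countable_bigcupT_measurable.
  exact: countableP.
by move=> kappa; apply: measurableX; exact: measurable_grid_cell.
Qed.

(** Cauchy-Schwarz in the form [q <= theta + q ^+ 2 / theta] for the mass [q] of
    each cell; the sum of the squares of the masses is the mass of [same_cell]. *)
Lemma cells_mass_le (r : R) (Q : seq {ffun 'I_d -> int}) (M theta : R) :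
  0 < r -> 0 < theta ->
  ((nu \x nu) (same_cell r) <= M%:E)%E ->
  (nu [set s | grid_cell r (z s) \in Q] <=
   (theta * (size Q)%:R + M / theta)%:E)%E.
Proof.
move=> r0 th0 hM; pose c kappa := [set s | grid_cell r (z s) = kappa].
have mc kappa : measurable (c kappa) by exact: measurable_grid_cell.
pose q kappa := fine (nu (c kappa)).
have qE kappa : nu (c kappa) = (q kappa)%:E by rewrite fineK // fin_num_measure.
have q0 kappa : 0 <= q kappa by rewrite -lee_fin -qE.
pose Q' := undup Q.
have h1 : (nu [set s | grid_cell r (z s) \in Q] <= (\sum_(k <- Q') q k)%:E)%E.
  have -> : [set s | grid_cell r (z s) \in Q] = \big[setU/set0]_(k <- Q') c k.
    rewrite -bigcup_seq; apply/seteqP; split => s /=.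
      by move=> h; exists (grid_cell r (z s)) => //=; rewrite mem_undup.
    by move=> [k /=]; rewrite mem_undup => kQ; rewrite /c /= => ->.
  apply: (le_trans (measure_bigsetU_seq_le nu mc _)).
  rewrite -sumEFin; apply: lee_sum => k _.
  by rewrite le_eqVlt; apply/orP; left; apply/eqP; exact: qE.
have h2 : ((\sum_(k <- Q') q k ^+ 2)%:E <= (nu \x nu) (same_cell r))%E.
  rewrite -sumEFin.
  have -> : (\sum_(k <- Q') (q k ^+ 2)%:E = \sum_(k <- Q') (nu \x nu) (c k `*` c k))%E.
    apply: eq_bigr => k _; rewrite product_measure1E // expr2 EFinM; congr (_ * _)%E;
    exact: esym (qE k).
  rewrite -(@measure_bigsetU_seq _ _ _ _ _ (fun k => c k `*` c k)); first last.
  - move=> i j ij; apply/seteqP; split => // -[x y] [[/= xi _] [/= xj _]].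
    by move: ij; rewrite -xi -xj eqxx.
  - exact: undup_uniq.
  - by move=> k; apply: measurableX.
  apply: le_measure; rewrite ?inE //.
  - by apply: bigsetU_measurable => k _; apply: measurableX.
  - exact: measurable_same_cell.
  - rewrite same_cellE -bigcup_seq => p [k _ kp]; by exists k.
apply: (le_trans h1); rewrite lee_fin.
have h3 : \sum_(k <- Q') q k ^+ 2 <= M by rewrite -lee_fin; exact: le_trans hM.
apply: (@le_trans _ _ (\sum_(k <- Q') (theta + q k ^+ 2 / theta))).
  apply: ler_sum => k _.
  have := sqr_ge0 (q k - theta); have := q0 k => hq hs.
  rewrite -[leRHS](@mulfK _ theta) ?gt_eqF // ler_pdivlMr // mulrDl divfK ?gt_eqF //.
  nra.
rewrite big_split /= -mulr_suml; apply: lerD; last first.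
  by apply: ler_wpM2r => //; rewrite invr_ge0 ltW.
rewrite big_const_seq count_predT iter_addr_0 -[leLHS]mulr_natr; apply: ler_wpM2l; first exact: ltW.
by rewrite ler_nat size_undup.
Qed.

(** If the image had measure zero, finitely many boxes of small total volume
    would carry more than three quarters of the mass. At a fine scale satisfying
    the hypothesis these boxes meet few cells of the grid, which carry little
    mass by [cells_mass_le]. *)
Theorem lebesgue_positive_image (K : R) (S0 : set S) (E : set 'rV[R]_d) : 0 < K ->
  (forall N, exists2 n, (N <= n)%N &
    ((nu \x nu) (same_cell (dyadic n)) <= (K * dyadic n ^+ d)%:E)%E) ->
  measurable S0 -> nu S0 = 1%E ->
  (forall s, S0 s -> E (\row_i z s i)) ->
  (0 < lebesgue_measure_rV E)%E.
Proof.
move=> K0 hK mS0 nuS0 hE.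
have leb0 : (0 <= lebesgue_measure_rV E)%E.
  apply: le_ereal_inf_tmp => _ [a [b [[ab _] ->]]].
  by apply: nneseries_ge0 => k _ _; rewrite lee_fin prodr_ge0 // => i _; rewrite subr_ge0.
rewrite lt_neqAle leb0 andbT; apply/eqP => /esym leb.
(* At the end the boxes carry at most [4 * K * (2 * eta) + 1 / 4 = 1 / 2]. *)
pose eta := (32 * K)^-1.
have eta0 : 0 < eta by rewrite invr_gt0 mulr_gt0 // ltr0n.
have fin0 : lebesgue_measure_rV E \is a fin_num by rewrite leb.
have [_ [a [b [[ab cov] ->]]]] := lb_ereal_inf_adherent eta0 fin0.
rewrite -/(lebesgue_measure_rV E) leb add0e => sumlt.
have vol0 k : 0 <= box_volume (a k) (b k).
  by rewrite prodr_ge0 // => i _; rewrite subr_ge0.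
have vol N : \sum_(k < N) box_volume (a k) (b k) <= eta.
  rewrite -lee_fin; apply: le_trans (ltW sumlt).
  rewrite -sumEFin -(big_mkord xpredT (fun k => (box_volume (a k) (b k))%:E)).
  by apply: nneseries_lim_ge => k _ _; rewrite lee_fin.
pose bx k := [set s | forall i, a k ord0 i <= z s i <= b k ord0 i].
have mbx k : measurable (bx k).
  rewrite (_ : bx k = \bigcap_(i : 'I_d) ((fun s => z s i) @^-1`
     `[a k ord0 i, b k ord0 i])).
    apply: fin_bigcap_measurable => // i _; rewrite -[X in measurable X]setTI.
    by apply: mz => //; exact: measurable_itv.
  apply/seteqP; split => s /= h; first by move=> i _; rewrite /= in_itv /=.
  by move=> i; have := h i I; rewrite /= in_itv.
pose U N := \big[setU/set0]_(k < N) bx k.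
have mU N : measurable (U N) by apply: bigsetU_measurable.
have [N hN] : exists N, ((3 / 4)%:E < nu (U N))%E.
  apply: contrapT => /forallNP h.
  have cvgU : nu (U n) @[n --> \oo] --> nu (\bigcup_n U n).
    apply: nondecreasing_cvg_mu => //; first exact: bigcupT_measurable.
    by move=> m n mn; apply/subsetPset; exact: subset_bigsetU.
  have : (nu (\bigcup_n U n) <= (3 / 4)%:E)%E.
    rewrite -(cvg_lim _ cvgU) //; apply: lime_le; first by apply/cvg_ex; eexists; exact: cvgU.
    by apply: nearW => n; rewrite leNgt; apply/negP/h.
  have : (1 <= nu (\bigcup_n U n))%E.
    rewrite -nuS0; apply: le_measure; rewrite ?inE //; first exact: bigcupT_measurable.
    move=> s /hE /cov[k _ hk]; exists k.+1 => //; rewrite /U big_ord_recr; right.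
    by move=> i; have := hk i; rewrite mxE.
  move=> h1 h2; have := le_trans h1 h2; rewrite lee_fin; lra.
have [delta d0 hdelta] := inflated_volume_le (index_enum 'I_N)
   (fun k i => b k ord0 i - a k ord0 i) eta0.
have [n0 hn0] := dyadic_small d0.
have [n n0n hn] := hK n0.
have r0 := dyadic_gt0 (R := R) n.
have rd : dyadic n < delta.
  apply: le_lt_trans hn0; rewrite /dyadic; apply: ler_wiXn2l => //.
  by rewrite invf_le1 // ler1n.
have hQ (k : 'I_N) := @grid_cells_of_box R d (dyadic n) (fun i => a k ord0 i)
  (fun i => b k ord0 i) r0 (ab k).
have {hQ} [Q hQ] := choice hQ.
pose QQ := flatten [seq Q k | k <- index_enum 'I_N].
have sQQ : (size QQ)%:R * dyadic n ^+ d <= 2 * eta.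
  rewrite size_flatten /shape -map_comp sumnE big_map natr_sum mulr_suml.
  apply: (@le_trans _ _ (\sum_(k < N) \prod_(i < d)
     (b k ord0 i - a k ord0 i + 2 * dyadic n))).
    by apply: ler_sum => k _; case: (hQ k).
  apply: (le_trans (hdelta (dyadic n) _)); first by rewrite (ltW r0).
  have := vol N; rewrite /box_volume => hv; lra.
have rn0 : 0 < dyadic n ^+ d :> R by exact: exprn_gt0.
have th0 : 0 < 4 * K * dyadic n ^+ d :> R by rewrite !mulr_gt0.
have := cells_mass_le QQ r0 th0 hn.
have : (nu (U N) <= nu [set s | grid_cell (dyadic n) (z s) \in QQ])%E.
  apply: le_measure; rewrite ?inE //.
    rewrite (_ : [set _ | _] = \big[setU/set0]_(k <- QQ)
      [set s | grid_cell (dyadic n) (z s) = k]).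
      by apply: bigsetU_measurable => k _; exact: measurable_grid_cell.
    rewrite -bigcup_seq; apply/seteqP; split => s /= => [h|[k /= kQ ->]] //.
    by exists (grid_cell (dyadic n) (z s)).
  rewrite /U -bigcup_mkord => s [k /= kN ks].
  apply/flattenP; exists (Q (Ordinal kN)); first by apply: map_f; rewrite mem_index_enum.
  by case: (hQ (Ordinal kN)) => + _; apply.
move=> h1 h2; have := lt_le_trans hN (le_trans h1 h2); rewrite lte_fin.
have -> : K * dyadic n ^+ d / (4 * K * dyadic n ^+ d) = 4^-1.
  by field; rewrite !gt_eqF.
have h3 := ler_wpM2l (ltW K0) sQQ.
have h4 : K * (2 * eta) = 16^-1 by rewrite /eta; field; rewrite gt_eqF.
rewrite h4 in h3.
have -> : 4 * K * dyadic n ^+ d * (size QQ)%:R = 4 * (K * ((size QQ)%:R * dyadic n ^+ d)) by ring.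
lra.
Qed.

End image_measure.

(** * Random images *)

Lemma limn_einf_sup (R : realType) (u : nat -> \bar R) :
  limn_einf u = ereal_sup (range (einfs u)).
Proof. by rewrite limn_einf_lim; apply: cvg_lim => //; exact: cvg_einfs_sup. Qed.

Lemma limn_einf_le_frequently (R : realType) (u : nat -> \bar R) :
  (forall n, 0 <= u n)%E -> (limn_einf u < +oo)%E ->
  exists2 K : R, 0 < K & forall N, exists2 n, (N <= n)%N & (u n <= K%:E)%E.
Proof.
move=> u0 uoo.
have hle N : (einfs u N <= limn_einf u)%E.
  by rewrite limn_einf_sup; apply: ereal_sup_ubound; exists N.
have L0 : (0 <= limn_einf u)%E.
  apply: le_trans (hle 0%N); apply: le_ereal_inf_tmp => _ [n _ <-]; exact: u0.
have fL : limn_einf u \is a fin_num by rewrite ge0_fin_numE.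
exists (fine (limn_einf u) + 1) => [|N].
  by rewrite ltr_wpDl // fine_ge0.
have : (einfs u N < (fine (limn_einf u) + 1)%:E)%E.
  by apply: (le_lt_trans (hle N)); rewrite EFinD fineK // lteDl // lte01.
by move=> /ereal_inf_lt[_ [n Nn <-] /ltW h]; exists n.
Qed.

Lemma limn_einf_le (R : realType) (u : nat -> \bar R) (C : \bar R) :
  (forall n, u n <= C)%E -> (limn_einf u <= C)%E.
Proof.
move=> uC; rewrite limn_einf_sup; apply: ge_ereal_sup => _ [n _ <-].
by apply: le_trans (uC n); apply: ereal_inf_lbound; exists n => /=.
Qed.

Section random_image.
Context {dT : measure_display} {T : measurableType dT} {R : realType}.
Context {dS : measure_display} {S : measurableType dS}.
Variables (P : probability T R) (nu : probability S R) (d : nat).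
Variable Z : T -> S -> 'I_d -> R.
Hypothesis mZ : forall i, measurable_fun setT (fun p : T * S => Z p.1 p.2 i).

Definition collision (r : R) : set (T * (S * S)) :=
  [set q | grid_cell r (Z q.1 q.2.1) = grid_cell r (Z q.1 q.2.2)].

Lemma measurable_collision r : 0 < r -> measurable (collision r).
Proof.
move=> r0.
have m1 : measurable_fun setT (fun q : T * (S * S) => (q.1, q.2.1)).
  apply: measurable_fun_pair => //.
  exact: (measurableT_comp measurable_fst measurable_snd).
have m2 : measurable_fun setT (fun q : T * (S * S) => (q.1, q.2.2)).
  apply: measurable_fun_pair => //.
  exact: (measurableT_comp measurable_snd measurable_snd).
have c kappa : measurable [set p : T * S | grid_cell r (Z p.1 p.2) = kappa].
  exact: (measurable_grid_cell (z := fun p : T * S => Z p.1 p.2) mZ kappa r0).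
rewrite (_ : collision r = \bigcup_kappa
   ((fun q : T * (S * S) => (q.1, q.2.1)) @^-1` [set p | grid_cell r (Z p.1 p.2) = kappa] `&`
    (fun q : T * (S * S) => (q.1, q.2.2)) @^-1` [set p | grid_cell r (Z p.1 p.2) = kappa])).
  apply: countable_bigcupT_measurable; first exact: countableP.
  move=> kappa; apply: measurableI; rewrite -[X in measurable X]setTI.
    exact: m1.
  exact: m2.
apply/seteqP; split=> q /=; rewrite /collision /=.
  by move=> h; exists (grid_cell r (Z q.1 q.2.1)).
by move=> [kappa _ [/= -> ->]].
Qed.

(** By Tonelli's theorem the expected mass of pairs in a common cell of side
    [dyadic n] is [O(dyadic n ^+ d)], and Fatou's lemma makes the bound hold
    almost surely, with a random constant, for infinitely many [n]. *)
Theorem random_positive_image (C : R) (S0 : set S) :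
  measurable S0 -> nu S0 = 1%E ->
  (forall n, (\int[nu \x nu]_p
     P [set w | grid_cell (dyadic n) (Z w p.1) = grid_cell (dyadic n) (Z w p.2)] <=
     (C * dyadic n ^+ d)%:E)%E) ->
  {ae P, forall w, forall E : set 'rV[R]_d,
     (forall s, S0 s -> E (\row_i Z w s i)) -> (0 < lebesgue_measure_rV E)%E}.
Proof.
move=> mS0 nuS0 hC.
pose m := [the probability (S * S)%type R of (nu \x nu)%E].
pose A n := collision (dyadic n).
have mA n : measurable (A n) by apply: measurable_collision; exact: dyadic_gt0.
pose f n w := ((2 ^+ n ^+ d)%:E * m (xsection (A n) w))%E.
have f0 n w : (0 <= f n w)%E by rewrite mule_ge0 // lee_fin !exprn_ge0.
have mx n : measurable_fun setT (fun w => m (xsection (A n) w)).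
  exact: measurable_fun_xsection.
have mf n : measurable_fun setT (f n) by apply: emeasurable_funM.
have intf n : (\int[P]_w f n w <= C%:E)%E.
  have c0 : (0 <= (2 ^+ n ^+ d : R)%:E)%E by rewrite lee_fin !exprn_ge0.
  rewrite (ge0_integralZl P measurableT (mx n) (fun w _ => measure_ge0 m _) c0).
  have -> : (\int[P]_w m (xsection (A n) w) = \int[m]_p P (ysection (A n) p))%E.
    have := indic_fubini_tonelli P m (mA n).
    by rewrite indic_fubini_tonelli_FE // indic_fubini_tonelli_GE.
  have h : (\int[m]_p P (ysection (A n) p) <= (C * dyadic n ^+ d)%:E)%E.
    apply: le_trans (hC n); rewrite le_eqVlt; apply/orP; left; apply/eqP.
    apply: eq_integral => p _; congr (P _); apply/seteqP; split=> w /=.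
      by rewrite ysectionP /=.
    by move=> hw; rewrite /ysection /= inE.
  apply: (le_trans (lee_wpmul2l _ h)); first exact: c0.
  rewrite -EFinM lee_fin mulrCA -exprMn (mulrC _ (dyadic n)) dyadicM expr1n mulr1.
  exact: lexx.
have hF : (\int[P]_w limn_einf (f^~ w) <= C%:E)%E.
  apply: (le_trans (fatou P measurableT mf (fun n w _ => f0 n w))).
  exact: limn_einf_le.
have L0 w : (0 <= limn_einf (f^~ w))%E.
  rewrite limn_einf_sup; apply: (@le_trans _ _ (einfs (f^~ w) 0)).
    by apply: le_ereal_inf_tmp => _ [k _ <-].
  by apply: ereal_sup_ubound; exists 0%N.
have iL : P.-integrable setT (fun w => limn_einf (f^~ w)).
  apply/integrableP; split; first by rewrite (_ : (fun w => limn_einf (f^~ w)) =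
      (fun w => - limn_esup (fun n => - f n w))%E);
    [apply: measurableT_comp => //; apply: measurable_fun_limn_esup => n; exact: measurableT_comp|].
  under eq_integral do rewrite gee0_abs //.
  exact: le_lt_trans hF (ltry _).
have := integrable_ae measurableT iL; apply: filterS => w /(_ I) fin E hE.
have [K K0 hK] := @limn_einf_le_frequently R (f^~ w) (f0^~ w)
  (eq_ind _ is_true fin _ (ge0_fin_numE (L0 w))).
apply: (@lebesgue_positive_image _ S R nu d (Z w) _ K S0 E K0) => //.
  by move=> i; exact: measurableT_comp (mZ i) (measurable_pair1 w).
move=> N; have [n Nn hn] := hK N; exists n => //.
have <- : m (xsection (A n) w) = (nu \x nu)%E (same_cell (Z w) (dyadic n)).
  congr (_ _); apply/seteqP; split=> p /=; first by rewrite xsectionP.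
  by move=> hp; rewrite /xsection /= inE.
have r0 := dyadic_gt0 (R := R) n.
have fx : m (xsection (A n) w) \is a fin_num.
  by apply: fin_num_measure; exact: measurable_xsection.
move: hn; rewrite /f -(fineK fx) -EFinM !lee_fin.
set x := fine _ => hx; have r1 : dyadic n ^+ d * 2 ^+ n ^+ d = 1 :> R.
  by rewrite -exprMn dyadicM expr1n.
rewrite -[leLHS]mul1r -r1 -mulrA [leRHS]mulrC.
by apply: ler_wpM2l => //; rewrite exprn_ge0 // ltW.
Qed.

End random_image.

(** * Joint measurability of the paths *)

(** Preimages of open intervals under a coordinate are open. *)
Lemma borel_measurable_coordinate (R : realType) (d : nat) (D : set R)
    (f : R -> 'rV[R]_d) (i : 'I_d) :
  borel_measurable_fun D f -> measurable_fun D (fun t => f t ord0 i).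
Proof.
move=> mf.
have mc : measurable_fun setT
    (fun x : g_sigma_algebraType (@open 'rV[R]_d) => (x : 'rV[R]_d) ord0 i).
  apply: (measurability _ (RGenOpens.measurableE R)) => //.
  move=> _ [_ [a [b ->]] <-]; rewrite setTI.
  apply: sub_sigma_algebra; apply: open_comp; last exact: interval_open.
  by move=> x _; exact: coord_continuous.
exact: (measurableT_comp mc mf).
Qed.

Section joint_measurability.
Context {disp : measure_display} {T : measurableType disp} {R : realType}.
Variable P : probability T R.
Variables (X : R -> {RV P >-> R}) (tau : R -> R).
Hypothesis cX : forall w, {within `[0, 1], continuous (fun t => X t w)}.
Hypothesis mtau : measurable_fun [set: measurableTypeR R] (tau : _ -> measurableTypeR R).
Hypothesis tau01 : forall s, 0 <= tau s < 1.

Definition dyadic_floor (n : nat) (t : R) : R :=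
  (Num.truncn (t * 2 ^+ n))%:R * dyadic n.

Lemma dyadic_floor_itv n t : 0 <= t -> dyadic_floor n t <= t < dyadic_floor n t + dyadic n.
Proof.
move=> t0; have h0 := dyadic_gt0 (R := R) n; have hM := dyadicM (R := R) n.
have pp : 0 <= t * 2 ^+ n by rewrite mulr_ge0 // exprn_ge0.
have := truncn_itv pp; rewrite -(natr1 (Num.truncn _)) => /andP[h1 h2].
have e : t = t * 2 ^+ n * dyadic n by rewrite -mulrA (mulrC _ (dyadic _)) hM mulr1.
rewrite /dyadic_floor -[X in _ + X]mul1r -mulrDl {2 3}e ler_pM2r // ltr_pM2r //.
by rewrite h1 h2.
Qed.

(** The time is approximated by its dyadic floor: each approximation is a
    countable gluing of products, and the approximations converge by continuity
    of the paths. *)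
Lemma measurable_path_at : measurable_fun [set: T * measurableTypeR R]
  (fun p : T * measurableTypeR R => X (tau p.2) p.1).
Proof.
apply: (measurable_realfun.measurable_fun_cvg (D := setT)
  (h := fun n (p : T * measurableTypeR R) => X (dyadic_floor n (tau p.2)) p.1)).
  move=> n _ Y mY; rewrite setTI.
  rewrite (_ : _ @^-1` _ = \bigcup_(k : nat) ((X (k%:R * dyadic n) @^-1` Y) `*`
     (tau @^-1` [set t | (0 <= t) && (Num.truncn (t * 2 ^+ n) == k)]))).
    apply: bigcupT_measurable => k; apply: measurableX.
      by rewrite -[X in measurable X]setTI; exact: measurable_funPT.
    rewrite -[X in measurable X]setTI; apply: mtau => //.
    rewrite (_ : [set _ | _] = `[k%:R * dyadic n, (k%:R + 1) * dyadic n[%classic).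
      exact: measurable_itv.
    have h0 := dyadic_gt0 (R := R) n; have hM := dyadicM (R := R) n.
    have e (t : R) : t = t * 2 ^+ n * dyadic n by rewrite -mulrA (mulrC _ (dyadic _)) hM mulr1.
    apply/seteqP; split => t /=; rewrite in_itv /=.
      move=> /andP[t0]; rewrite truncn_eq ?mulr_ge0 ?exprn_ge0 // -(natr1 k).
      by rewrite {3 4}(e t) ler_pM2r // ltr_pM2r.
    move=> ht; have t0 : 0 <= t.
      by have /andP[h _] := ht; apply: le_trans h; rewrite mulr_ge0 // ltW.
    rewrite t0 truncn_eq ?mulr_ge0 ?exprn_ge0 // -(natr1 k).
    by move: ht; rewrite {1 2}(e t) ler_pM2r // ltr_pM2r.
  apply/seteqP; split => -[w s] /=; rewrite /dyadic_floor.
    move=> h; exists (Num.truncn (tau s * 2 ^+ n)) => //; split => //=.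
    by have /andP[-> _] := tau01 s; rewrite eqxx.
  by move=> [k _ [/= h /andP[_ /eqP ->]]].
move=> [w s] _ /=.
have /subspace_continuousP cw : {within `[0, 1], continuous (fun t => X t w)}.
  exact: cX.
have /andP[t0 t1] := tau01 s.
have t01 : `[0, 1]%classic (tau s) by rewrite /= in_itv /= t0 ltW.
have := cw _ t01 => /cvgrPdist_lt h; apply/cvgrPdist_lt => e e0.
have := h e e0; rewrite /within /= => /nbhs_ballP[delta /= d0 hd].
have [k hk] := dyadic_small d0.
near=> n; have kn : (k <= n)%N by near: n; exact: nbhs_infty_ge.
have /andP[h1 h2] := dyadic_floor_itv n t0.
have d00 : 0 <= dyadic_floor n (tau s) by rewrite mulr_ge0 // ltW // dyadic_gt0.
apply: hd; last by rewrite /= in_itv /= d00 (le_trans h1) // ltW.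
rewrite /ball /=; have hn : dyadic n <= dyadic k :> R.
  by rewrite /dyadic; apply: ler_wiXn2l => //; rewrite invf_le1 // ler1n.
rewrite ger0_norm ?subr_ge0 // ltrBlDl; apply: (lt_trans h2); rewrite ltrD2l.
exact: le_lt_trans hk.
Unshelve. all: by end_near.
Qed.

End joint_measurability.

Lemma path_coordinate_continuous (disp : measure_display)
    (T : measurableType disp) (R : realType) (P : probability T R) (d : nat)
    (I : set R) (B : 'I_d -> R -> {RV P >-> R}) (i : 'I_d) w :
  {within I, continuous (fun t => vector_process B t w)} ->
  {within I, continuous (fun t => B i t w)}.
Proof.
move=> cB.
rewrite (_ : (fun t => B i t w) =
  (fun x : 'rV[R]_d => x ord0 i) \o (fun t => vector_process B t w)); last first.
  by apply/funext => t /=; rewrite /vector_process mxE.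
move=> t; apply: (@continuous_comp (subspace I) _ _
  (fun t => vector_process B t w) (fun x : 'rV[R]_d => x ord0 i)).
  exact: cB.
exact: coord_continuous.
Qed.

(** * Mass of neighbouring cells *)

Section neighbours.
Context {R : realType} (d : nat).
Variables (H beta : R) (f : R -> 'rV[R]_d) (G : set R) (m : 'I_d -> R).
Hypothesis H01 : 0 < H < 1.
Hypothesis mG : measurable G.
Hypothesis G01 : forall t, G t -> 0 <= t < 1.
Hypothesis Gf : forall t, G t -> forall i, m i <= f t ord0 i < m i + 1.
Hypothesis mf : forall i, measurable_fun G (fun t => f t ord0 i).
Local Notation S := (measurableTypeR R).
Variables (nu : probability S R) (C : R) (v : nat -> R).
Hypothesis nuG : nu G = 1%E.
Hypothesis nuC : forall n (kappa : 'I_d.+1 -> nat),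
  (nu (G `&` [set t | forall j, cell (scaling H) (graph_point f m t) n j = kappa j])
    <= (C * v n)%:E)%E.
Variable tau : S -> S.
Hypothesis mtau : measurable_fun [set: S] tau.
Hypothesis tauG : forall s, G (tau s).
Hypothesis tau_id : forall s, G s -> tau s = s.

Definition index_at k (t : R) j := cell (scaling H) (graph_point f m t) k j.

(** Points at small parabolic distance may lie in different cells, but then these
    cells are neighbours. *)
Definition neighbours k : set (S * S) :=
  [set p | forall j, (index_at k (tau p.1) j <= (index_at k (tau p.2) j).+1)%N &&
                     (index_at k (tau p.2) j <= (index_at k (tau p.1) j).+1)%N].

Definition index_class k (kappa : {ffun 'I_d.+1 -> nat}) : set S :=
  [set s | forall j, index_at k (tau s) j = kappa j].

Lemma measurable_graph_point j : measurable_fun G (fun t => graph_point f m t j).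
Proof.
rewrite /graph_point; case: unlift => [i|]; last exact: measurable_id.
exact: measurable_funB.
Qed.

Lemma measurable_index_class k kappa : measurable (index_class k kappa).
Proof.
rewrite (_ : index_class k kappa = \bigcap_(j : 'I_d.+1)
  (tau @^-1` (G `&` [set t | index_at k t j = kappa j]))).
  apply: fin_bigcap_measurable => // j _.
  rewrite -[X in measurable X]setTI; apply: mtau => //.
  apply: measurable_cell => //; first exact: graph_point_unit.
  exact: measurable_graph_point.
apply/seteqP; split => s /= h; first by move=> j _; split; [exact: tauG|exact: h].
by move=> j; have [] := h j I.
Qed.

Lemma index_class_le k kappa : (nu (index_class k kappa) <= (C * v k)%:E)%E.
Proof.
have mc := measurable_index_class k kappa.
have nuG' : nu (~` G) = 0%E by rewrite probability_setC // nuG subee.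
have mG2 : measurable (index_class k kappa `&` G) by exact: measurableI.
have mG3 : measurable (index_class k kappa `&` ~` G).
  by apply: measurableI => //; exact: measurableC.
have -> : index_class k kappa = (index_class k kappa `&` G) `|` (index_class k kappa `&` ~` G).
  by rewrite -setIUr setUv setIT.
apply: (@le_trans _ _ (nu (index_class k kappa `&` G) +
  nu (index_class k kappa `&` ~` G))%E); first exact: measureU2.
have h0 : nu (index_class k kappa `&` ~` G) = 0%E.
  apply/eqP; rewrite eq_le measure_ge0 andbT -nuG'.
  apply: le_measure; rewrite ?inE //; first exact: measurableC.
have e : index_class k kappa `&` G = G `&`
    [set t | forall j, cell (scaling H) (graph_point f m t) k j = kappa j].
  apply/seteqP; split => s /=.
    by move=> [h Gs]; split => // j; have := h j; rewrite /index_at tau_id.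
  by move=> [Gs h]; split => // j; rewrite /index_at tau_id //; exact: h.
by rewrite h0 adde0 e; exact: nuC.
Qed.

Lemma neighboursE k : neighbours k =
  \bigcup_(kk in [set kk : {ffun 'I_d.+1 -> nat} * {ffun 'I_d.+1 -> nat} |
     forall j, (kk.1 j <= (kk.2 j).+1)%N && (kk.2 j <= (kk.1 j).+1)%N])
   (index_class k kk.1 `*` index_class k kk.2).
Proof.
apply/seteqP; split => -[s s'] /=.
  move=> h; exists ([ffun j => index_at k (tau s) j], [ffun j => index_at k (tau s') j]).
    by move=> j; rewrite /= !ffunE; exact: h.
  by split => j /=; rewrite ffunE.
move=> [[k1 k2] /= hk [/= h1 h2]] j; rewrite /= h1 h2; exact: hk.
Qed.

Lemma measurable_neighbours k : measurable (neighbours k).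
Proof.
rewrite neighboursE (_ : \bigcup_(kk in _) _ =
  \bigcup_(kk : {ffun 'I_d.+1 -> nat} * {ffun 'I_d.+1 -> nat})
  (if `[< forall j, (kk.1 j <= (kk.2 j).+1)%N && (kk.2 j <= (kk.1 j).+1)%N >] then
   index_class k kk.1 `*` index_class k kk.2 else set0)).
  apply: countable_bigcupT_measurable; first exact: countableP.
  move=> kk; case: ifP => // _; apply: measurableX; exact: measurable_index_class.
apply/seteqP; split => p.
  by move=> [kk hk hp]; exists kk => //; rewrite asboolT.
by move=> [kk _]; case: asboolP => // hk hp; exists kk.
Qed.

Definition neighbour_number : nat := #|{ffun 'I_d.+1 -> 'I_3}|.

(** A cell has at most [3 ^ (d + 1)] neighbours, and each has mass at most [C * v
    k]. *)
Lemma neighbours_le k : 0 <= C * v k ->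
  ((nu \x nu) (neighbours k) <= (neighbour_number%:R * (C * v k))%:E)%E.
Proof.
move=> Cv0; rewrite /product_measure1.
have h s : (nu (xsection (neighbours k) s) <= (neighbour_number%:R * (C * v k))%:E)%E.
  (* A neighbour is reached by moving each index by [e j - 1]. *)
  pose kap (e : {ffun 'I_d.+1 -> 'I_3}) : {ffun 'I_d.+1 -> nat} :=
    [ffun j => (index_at k (tau s) j + e j).-1].
  have mk e : measurable (index_class k (kap e)) by exact: measurable_index_class.
  apply: (@le_trans _ _ (nu (\big[setU/set0]_(e <- index_enum
      {ffun 'I_d.+1 -> 'I_3}) index_class k (kap e)))).
    apply: le_measure; rewrite ?inE //.
    - by apply: measurable_xsection; exact: measurable_neighbours.
    - exact: bigsetU_measurable.
    - rewrite -bigcup_seq => s'; rewrite xsectionP /neighbours /= => hs.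
      have lt3 j : ((index_at k (tau s') j).+1 - index_at k (tau s) j < 3)%N.
        have /andP[_ h2] := hs j; move: h2 => /=.
        by set a := index_at _ _ _; set b := index_at _ _ _; lia.
      exists [ffun j => Ordinal (lt3 j)]; first by rewrite /= mem_index_enum.
      move=> j; rewrite !ffunE /=; have /andP[h1 _] := hs j; lia.
  apply: (le_trans (measure_bigsetU_seq_le nu mk _)).
  apply: (@le_trans _ _ (\sum_(e : {ffun 'I_d.+1 -> 'I_3}) (C * v k)%:E)%E).
    by apply: lee_sum => e _; exact: index_class_le.
  rewrite sumEFin (_ : \sum_(e : {ffun 'I_d.+1 -> 'I_3}) C * v k =
    neighbour_number%:R * (C * v k)) //.
  by rewrite sumr_const mulr_natl.
apply: (@le_trans _ _ (\int[nu]_x (neighbour_number%:R * (C * v k))%:E)%E).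
  apply: ge0_le_integral => //.
  - by apply: measurable_fun_xsection; exact: measurable_neighbours.
  - by move=> s _; exact: h.
rewrite integral_cst // -[leRHS]mule1; apply: lee_wpmul2l; first by rewrite lee_fin mulr_ge0.
exact: probability_le1.
Qed.

End neighbours.

(** * Collision probabilities and the theorem *)

Section collision_bound.
Context {disp : measure_display} {T : measurableType disp} {R : realType}.
Variables (P : probability T R) (d : nat) (H : R) (B : 'I_d -> R -> {RV P >-> R}).
Variables (f : R -> 'rV[R]_d) (m : 'I_d -> R).
Hypothesis H01 : 0 < H < 1.
Hypothesis hB : is_fBm H `[0, 1] B.

Definition scale_radius (k : nat) : R := dyadic k `^ H.

Lemma scale_radius_gt0 k : 0 < scale_radius k.
Proof. by rewrite powR_gt0 // dyadic_gt0. Qed.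

Lemma scale_radius_small n : exists k, scale_radius k.+1 <= dyadic n.
Proof.
have /andP[H0 _] := H01.
exists (Num.truncn (n%:R / H)); rewrite /scale_radius !dyadic_powR -powRrM mulNr.
apply: ler_powR; first by rewrite ler1n.
rewrite lerN2 -ler_pdivrMr //; apply: ltW; exact: truncnS_gt.
Qed.

Lemma cell_gap (k : nat) (j : 'I_d.+1) (p q : 'I_d.+1 -> R) :
  0 <= p j -> 0 <= q j ->
  ((cell (scaling H) q k j).+1 < cell (scaling H) p k j)%N ->
  dyadic (expo (scaling H) j k) <= `|p j - q j|.
Proof.
move=> p0 q0 gap; have /andP[h1 _] := cell_itv (scaling H) k p0.
have /andP[_ h2] := cell_itv (scaling H) k q0.
have h0 := dyadic_gt0 (R := R) (expo (scaling H) j k).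
set r := dyadic _ in h0 h1 h2 *.
set a := cell _ p k j in gap h1; set b := cell _ q k j in gap h2.
have : (b.+2)%:R <= a%:R :> R by rewrite ler_nat.
rewrite -addn2 natrD => h3; have h4 := ler_wpM2r (ltW h0) h3.
apply: le_trans (ler_norm _); lra.
Qed.

(** Indices that differ by two in some coordinate force a distance of at least
    one cell side in this coordinate. *)
Lemma not_neighbours_far k t s : 0 <= t < 1 -> 0 <= s < 1 ->
  unit_point (graph_point f m t) -> unit_point (graph_point f m s) ->
  ~ (forall j, (index_at H f m k t j <= (index_at H f m k s j).+1)%N &&
      (index_at H f m k s j <= (index_at H f m k t j).+1)%N) ->
  t != s /\ (scale_radius k <= `|t - s| `^ H \/
    exists i, scale_radius k <= `|- (f t ord0 i - f s ord0 i)|).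
Proof.
have /andP[H0 H1] := H01.
move=> t01 s01 ut us /existsNP[j /negP]; rewrite negb_and -!ltnNge => gap.
have tj : 0 <= graph_point f m t j by have /andP[] := ut j.
have sj : 0 <= graph_point f m s j by have /andP[] := us j.
have far : dyadic (expo (scaling H) j k) <= `|graph_point f m t j - graph_point f m s j|.
  case/orP: gap => gap; first exact: cell_gap gap.
  by rewrite distrC; exact: cell_gap gap.
have ts : t != s.
  apply/eqP => e; move: far; rewrite e subrr normr0 leNgt dyadic_gt0 //.
split => //; case: (unliftP ord0 j) far => [i ->|->].
  rewrite !graph_point_space => far; right; exists i.
  apply: (le_trans (dyadic_expo_ge H01 k i)); apply: (le_trans far).
  rewrite normrN le_eqVlt; apply/orP; left; apply/eqP; congr `|_|; ring.
rewrite !graph_point_time (expo_j0 (scaling_time H)) => far; left.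
by apply: ge0_ler_powR; rewrite ?nnegrE ?(ltW (dyadic_gt0 _)) // ltW.
Qed.

Lemma collision_sub n t s (w : T) :
  grid_cell (dyadic n) (fun i => B i t w + f t ord0 i) =
  grid_cell (dyadic n) (fun i => B i s w + f s ord0 i) ->
  forall i, - (f t ord0 i - f s ord0 i) - dyadic n <= B i t w - B i s w <=
    - (f t ord0 i - f s ord0 i) + dyadic n.
Proof.
move=> /ffunP h i; have := h i; rewrite !ffunE => e.
have r0 := dyadic_gt0 (R := R) n.
have := floor_itv ((B i t w + f t ord0 i) / dyadic n).
have := floor_itv ((B i s w + f s ord0 i) / dyadic n).
rewrite -e intrD !ler_pdivlMr // !ltr_pdivrMr // !mulrDl !mul1r.
set q := _%:~R * _ => /andP[h1 h2] /andP[h3 h4].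
by apply/andP; split; lra.
Qed.

Definition scale_weight (n k : nat) : R :=
  small_ball_constant R d * (dyadic n / scale_radius k.+1) ^+ d.

Lemma small_ball_constant_ge1 : 1 <= small_ball_constant R d.
Proof.
by apply: le_trans (small_ball_constant_ge R d); rewrite exprn_ege1 // ler1n.
Qed.

Lemma scale_weight_ge0 n k : 0 <= scale_weight n k.
Proof.
rewrite mulr_ge0 ?(le_trans ler01 small_ball_constant_ge1) //.
by rewrite exprn_ge0 // divr_ge0 // ltW // ?dyadic_gt0 // scale_radius_gt0.
Qed.

(** The relevant scale is the last one at which the cells are still neighbours:
    at the next level the two points are separated and [fBm_small_ball] applies.
    If the cells are neighbours at all levels, a level at which the weight is at
    least one is used. *)
Lemma collision_probability_le n t s : 0 <= t < 1 -> 0 <= s < 1 ->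
  unit_point (graph_point f m t) -> unit_point (graph_point f m s) ->
  exists2 k, (P [set w | grid_cell (dyadic n) (fun i => B i t w + f t ord0 i) =
       grid_cell (dyadic n) (fun i => B i s w + f s ord0 i)]%R <= (scale_weight n k)%:E)%E &
   forall j, (index_at H f m k t j <= (index_at H f m k s j).+1)%N &&
      (index_at H f m k s j <= (index_at H f m k t j).+1)%N.
Proof.
have /andP[H0 H1] := H01.
move=> t01 s01 ut us.
have mB i u : measurable_fun setT (B i u) by exact: measurable_funPT.
pose near k := forall j, (index_at H f m k t j <= (index_at H f m k s j).+1)%N &&
      (index_at H f m k s j <= (index_at H f m k t j).+1)%N.
have mcoll u v' : measurable [set w | grid_cell (dyadic n) (fun i => B i u w + f u ord0 i) =
       grid_cell (dyadic n) (fun i => B i v' w + f v' ord0 i)].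
  have mZ u' kappa : measurable
      [set w | grid_cell (dyadic n) (fun i => B i u' w + f u' ord0 i) = kappa].
    apply: (@measurable_grid_cell _ T R d (fun w i => B i u' w + f u' ord0 i));
      last exact: dyadic_gt0.
    by move=> i; apply: measurable_funD.
  rewrite (_ : [set w | _] = \bigcup_kappa
    ([set w | grid_cell (dyadic n) (fun i => B i u w + f u ord0 i) = kappa] `&`
     [set w | grid_cell (dyadic n) (fun i => B i v' w + f v' ord0 i) = kappa])).
    apply: countable_bigcupT_measurable; first exact: countableP.
    by move=> kappa; apply: measurableI.
  apply/seteqP; split => w /= h; last by case: h => kappa _ [-> ->].
  by exists (grid_cell (dyadic n) (fun i => B i u w + f u ord0 i)).
have [allnear|/existsNP far] := pselect (forall k, near k).
  have [k hk] := scale_radius_small n; exists k; last exact: allnear.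
  apply: (@le_trans _ _ 1%E); first exact: probability_le1.
  rewrite lee_fin /scale_weight -[leLHS]mulr1; apply: ler_pM => //.
    exact: small_ball_constant_ge1.
  by apply: exprn_ege1; rewrite ler_pdivlMr ?mul1r // scale_radius_gt0.
have {far} exfar : exists k, `[< ~ near k >].
  by have [k hk] := far; exists k; apply/asboolP.
have [k /asboolP fark kmin] := ex_minnP exfar.
case: k fark kmin => [|k] fark kmin.
  by exfalso; apply: fark => j; rewrite /index_at !cell0.
exists k; last first.
  by apply: contrapT => h; have := kmin k (asboolT h); rewrite ltnn.
have [ts hfar] := not_neighbours_far t01 s01 ut us fark.
have I01 (u : R) : 0 <= u < 1 -> `[0, 1]%classic u.
  by rewrite /= in_itv /= => /andP[-> /ltW].
apply: (@le_trans _ _ (P [set w | forall i,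
    - (f t ord0 i - f s ord0 i) - dyadic n <= B i t w - B i s w <=
    - (f t ord0 i - f s ord0 i) + dyadic n]%R)).
  apply: le_measure; rewrite ?inE //; last by move=> w; exact: collision_sub.
  rewrite (_ : [set w | _] = \bigcap_(i : 'I_d) ((fun w => B i t w - B i s w) @^-1`
     `[- (f t ord0 i - f s ord0 i) - dyadic n, - (f t ord0 i - f s ord0 i) + dyadic n])).
    apply: fin_bigcap_measurable => // i _; rewrite -[X in measurable X]setTI.
    by apply: measurable_funB => //; exact: measurable_itv.
  apply/seteqP; split => w /= h; first by move=> i _; rewrite /= in_itv /=.
  by move=> i; have := h i I; rewrite /= in_itv.
exact: (@fBm_small_ball _ _ _ P d H _ B H0 hB t s
  (fun i => - (f t ord0 i - f s ord0 i)) (dyadic n) (scale_radius k.+1)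
  (I01 _ t01) (I01 _ s01) ts (dyadic_gt0 n) (scale_radius_gt0 k.+1) hfar).
Qed.

End collision_bound.

Lemma geometric_sum_le (R : realType) (q : R) : 0 <= q < 1 ->
  (\sum_(0 <= k <oo) (q ^+ k)%:E <= ((1 - q)^-1)%:E)%E.
Proof.
move=> /andP[q0 q1]; apply: lime_le.
  by apply: is_cvg_nneseries => k _ _; rewrite lee_fin exprn_ge0.
apply: nearW => n; rewrite sumEFin lee_fin.
have q1' : 0 < 1 - q by rewrite subr_gt0.
rewrite -[leRHS]mul1r ler_pdivlMr // mulrC.
have -> : (1 - q) * (\sum_(0 <= i < n) q ^+ i) = 1 - q ^+ n.
  by rewrite -(opprB q 1) mulNr big_mkord -subrX1 opprB.
by rewrite lerBlDr lerDl exprn_ge0.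
Qed.

Unset Implicit Arguments.
Set Strict Implicit.
Set Printing Implicit Defensive.

Theorem theorem3p2 (R : realType) (d : nat) (hd : (1 <= d)%N)
    (H : R) (hH : 0 < H < 1)
    (disp : measure_display) (T : measurableType disp) (P : probability T R)
    (hP : measure_is_complete P)
    (B : 'I_d -> R -> {RV P >-> R}) (hB : is_fBm H `[0, 1] B)
    (f : R -> 'rV[R]_d) (hf : borel_measurable_fun `[0, 1] f)
    (A : set R) (mA : measurable A) (hA : A `<=` `[0, 1]) :
  ((H * d%:R)%:E < parabolic_dim H (graph A f))%E ->
  {ae P, forall w,
    (0 < lebesgue_measure_rV [set (vector_process B t w + f t)%R | t in A])%E}.
Proof.
move=> hdim; have /andP[H0 H1] := hH.
have Hd0 : 0 <= H * d%:R by rewrite mulr_ge0 // ltW.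
(* Any exponent between the two works: it makes the content positive and
   the energy finite. *)
have [beta betaHd beta_dim] : exists2 beta : R, H * d%:R < beta &
    (beta%:E < parabolic_dim H (graph A f))%E.
  case: parabolic_dim hdim => [x| |] //.
    rewrite lte_fin => hx; exists ((H * d%:R + x) / 2); last rewrite lte_fin.
      by have h := hx; lra.
    by have h := hx; lra.
  by move=> _; exists (H * d%:R + 1); [rewrite ltrDl|exact: ltry].
have beta0 : 0 < beta by exact: le_lt_trans betaHd.
have content_gt0 : (0 < parabolic_content H beta (graph A f))%E.
  rewrite lt_neqAle parabolic_content_ge0 andbT; apply/eqP => /esym h.
  move: beta_dim; rewrite ltNge => /negP; apply.
  by apply: ereal_inf_lbound; exists beta.
have [m hm] := exists_local_part beta0 hA content_gt0.
set G := local_part f A m in hm.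
pose m' i : R := (m i)%:~R.
have mfc i : measurable_fun (`[0, 1]%classic : set R) (fun t => f t ord0 i).
  exact: borel_measurable_coordinate.
have GA : G `<=` A by move=> t [].
have G01 t : G t -> 0 <= t < 1.
  by move=> [At [t1 _]]; have := hA _ At; rewrite /= in_itv /= t1 andbT => /andP[].
have Gf t : G t -> forall i, m' i <= f t ord0 i < m' i + 1 by move=> [_ [_ h]].
have mG : measurable G.
  rewrite (_ : G = A `&` `]-oo, 1[ `&` \bigcap_(i : 'I_d) ((`[0, 1]%classic : set R) `&`
     (fun t => f t ord0 i) @^-1` `[m' i, m' i + 1[)).
    apply: measurableI; first exact: measurableI.
    apply: fin_bigcap_measurable => // i _.
    by apply: mfc => //; exact: measurable_itv.
  apply/seteqP; split => t /=; rewrite in_itv /=.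
    by move=> [At [t1 h]]; split=> // i _; split; [exact: hA|rewrite /= in_itv /=; exact: h].
  move=> [[At t1] h]; split => //; split => // i.
  by have [_] := h i I; rewrite /= in_itv.
have mfG i : measurable_fun G (fun t => f t ord0 i).
  by apply: measurable_funS (mfc i) => // t /GA /hA.
have ccodes := net_content_codes_gt0 hH beta0 G01 Gf hm.
have upt t : G t -> unit_point (graph_point f m' t) by exact: graph_point_unit.
have [C [nu [C0 nuG nuC]]] := cell_frostman (scaling01 hH) (scaling_time H) mG upt
  (measurable_graph_point m' mfG) (fun t _ => graph_point_time f m' t)
  (fun n => powR_ge0 (dyadic n) beta) ccodes.
have [t0 Gt0] : exists t, G t.
  apply: contrapT => /forallNP h.
  have G0 : G = set0 by apply/seteqP; split => // t /h.
  by move: nuG; rewrite G0 measure0 => /eqP; rewrite eq_sym onee_eq0.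
(* The complement of [G] is a null set for [nu], but contains times at
   which neither [f] nor the paths are controlled; these are replaced by
   [t0]. *)
pose tau (s : measurableTypeR R) : measurableTypeR R := if s \in G then s else t0.
have tauG s : G (tau s) by rewrite /tau; case: ifPn => // /set_mem.
have tau_id s : G s -> tau s = s by move=> Gs; rewrite /tau mem_set.
have mtau : measurable_fun setT tau.
  apply: measurable_fun_ifT => //.
  apply: (measurable_fun_bool true); rewrite setTI (_ : _ @^-1` _ = G) //.
  by apply/seteqP; split => s /=; [move/set_mem|move/mem_set].
pose Z (w : T) (s : measurableTypeR R) (i : 'I_d) := B i (tau s) w + f (tau s) ord0 i.
have mZ i : measurable_fun setT (fun p : T * measurableTypeR R => Z p.1 p.2 i).
  apply: measurable_funD.
    apply: measurable_path_at => // [w|s]; last exact: G01.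
    by apply: path_coordinate_continuous; case: hB.
  have mft : measurable_fun setT (fun s : measurableTypeR R => f (tau s) ord0 i).
    by apply: (measurable_comp mG _ (mfG i) mtau) => _ [s _ <-].
  exact: (measurableT_comp mft measurable_snd).
pose N0 := neighbour_number d.
pose q : R := 2 `^ (H * d%:R - beta).
have q0 : 0 < q by exact: powR_gt0.
have q1 : q < 1.
  rewrite /q /powR gt_eqF // expR_lt1 pmulr_llt0 ?subr_lt0 //.
  by apply: ln_gt0; rewrite ltr1n.
pose K0 : R := small_ball_constant R d * 2 `^ (H * d%:R) * (N0%:R * C).
have sb0 : 0 <= small_ball_constant R d.
  apply: (@le_trans _ _ 1) => //; exact: small_ball_constant_ge1.
have K00 : 0 <= K0 by rewrite /K0 !mulr_ge0 // ?powR_ge0 // ltW.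
pose Nb k := neighbours H f m' tau k.
have mNb k : measurable (Nb k) by exact: (measurable_neighbours H mG G01 Gf mfG mtau tauG).
(* Collision weights against Frostman masses form a geometric series, of
   ratio less than one since [H * d < beta]. *)
have termE n k : scale_weight d H n k * (N0%:R * (C * dyadic k `^ beta)) =
    K0 * dyadic n ^+ d * q ^+ k.
  have E : (scale_radius H k.+1) ^- d * dyadic k `^ beta = 2 `^ (H * d%:R) * q ^+ k.
    rewrite /scale_radius !dyadic_powR -!powRrM -[in LHS]powR_mulrn ?powR_ge0 //.
    rewrite -powRrM -powRN -[q ^+ k]powR_mulrn ?(ltW q0) // -powRrM.
    rewrite -!powRD ?pnatr_eq0 ?implybT //.
    by congr (_ `^ _); rewrite -(natr1 k); ring.
  rewrite /scale_weight expr_div_n /K0.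
  transitivity (small_ball_constant R d * dyadic n ^+ d * (N0%:R * C) *
    ((scale_radius H k.+1) ^- d * dyadic k `^ beta)); first by ring.
  by rewrite E; ring.
apply: filterS (@random_positive_image _ T R _ (measurableTypeR R) P nu d Z mZ
    (K0 / (1 - q)) G mG nuG _) => [w hw|n].
  apply: hw => s Gs; exists s; first exact: GA.
  by apply/rowP => i; rewrite !mxE /Z tau_id.
have meas_coll : measurable_fun setT (fun p : measurableTypeR R * measurableTypeR R =>
   P [set w | grid_cell (dyadic n) (Z w p.1) = grid_cell (dyadic n) (Z w p.2)]).
  have := measurable_fun_ysection P (measurable_collision mZ (dyadic_gt0 (R := R) n)).
  congr (measurable_fun _ _); apply/funext => p /=; congr (P _).
  by apply/seteqP; split => w /=; rewrite /ysection /= inE.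
have meas_term k : measurable_fun setT (fun p : measurableTypeR R * measurableTypeR R =>
   (scale_weight d H n k * \1_(Nb k) p)%:E).
  by apply/measurable_EFinP; apply: measurable_funM => //; exact: measurable_indic.
have term_ge0 k p : (0 <= (scale_weight d H n k * \1_(Nb k) p)%:E)%E.
  by rewrite lee_fin mulr_ge0 // scale_weight_ge0.
apply: (@le_trans _ _ (\int[nu \x nu]_p \sum_(0 <= k <oo)
    (scale_weight d H n k * \1_(Nb k) p)%:E)%E).
  apply: ge0_le_integral => //.
    by apply: ge0_emeasurable_sum => //.
  move=> p _.
  have [k hk nk] := collision_probability_le hH hB n
    (G01 _ (tauG p.1)) (G01 _ (tauG p.2)) (upt _ (tauG p.1)) (upt _ (tauG p.2)).
  apply: (le_trans hk); apply: (@le_trans _ _ (scale_weight d H n k * \1_(Nb k) p)%:E).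
    by rewrite indicE mem_set ?mulr1.
  apply: (@le_trans _ _ (\sum_(0 <= i < k.+1)
      (scale_weight d H n i * \1_(Nb i) p)%:E)%E); last first.
    by apply: nneseries_lim_ge => i _ _.
  by rewrite big_nat_recr //= leeDr // sume_ge0.
rewrite integral_nneseries //.
apply: (@le_trans _ _ (\sum_(0 <= k <oo) ((K0 * dyadic n ^+ d)%:E * (q ^+ k)%:E))%E).
  apply: lee_nneseries => [k _ _|k _]; first exact: integral_ge0.
  rewrite -EFinM -termE EFinM.
  under eq_integral do rewrite EFinM.
  rewrite ge0_integralZl //; last 2 first.
  - by apply/measurable_EFinP; exact: measurable_indic.
  - by rewrite lee_fin scale_weight_ge0.
  apply: lee_wpmul2l; first by rewrite lee_fin scale_weight_ge0.
  rewrite integral_indic // setIT.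
  apply: (neighbours_le hH mG G01 Gf mfG nuG nuC mtau tauG tau_id (k := k)).
  by rewrite mulr_ge0 ?powR_ge0 ?(ltW C0).
rewrite nneseriesZl; last by move=> k _; rewrite lee_fin exprn_ge0 // ltW.
apply: (@le_trans _ _ ((K0 * dyadic n ^+ d)%:E * ((1 - q)^-1)%:E)%E).
  apply: lee_wpmul2l; first by rewrite lee_fin mulr_ge0 // exprn_ge0 // ltW // dyadic_gt0.
  by apply: geometric_sum_le; rewrite (ltW q0).
by rewrite -EFinM lee_fin mulrAC.
Qed.
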